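(* Let $f:\mathbb{G}_2\to\mathbb{G}_2$ be a holomorphic self-map of the symmetrized bidisc with no fixed point in $\mathbb{G}_2$. For $z_0\in\mathbb{G}_2$ let $$T(f,z_0):=\{\xi\in\partial\mathbb{G}_2: \text{there is a sequence } (n_k)_{k\in\mathbb{N}} \text{ with } f^{n_k}(z_0)\to\xi \text{ as } k\to\infty\},$$ and let $T(f):=\bigcup_{z\in\mathbb{G}_2}T(f,z)$ be the target set of $f$. Then: (i) If $T(f,z_0)\subset\{(2e^{i\theta},e^{2i\theta}):\theta\in[0,2\pi)\}\subset\partial\mathbb{G}_2$ for some $z_0\in\mathbb{G}_2$, then $T(f)\subset\{(2e^{i\theta},e^{2i\theta}):\theta\in[0,2\pi)\}$. (ii) If $z_0\in\mathbb{G}_2$ and $T(f,z_0)\subset\pi_2(\mathbb{D}\times\{e^{i\theta_0}\})$ for some $\theta_0\in\mathbb{R}$, then $T(f)\subset\pi_2(\overline{\mathbb{D}}\times\{e^{i\theta_0}\})\cup\pi_2(\{e^{i\theta_0}\}\times\overline{\mathbb{D}})$.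
   Context: $\mathbb{D}$ is the open unit disc in $\mathbb{C}$; $\pi_2:\mathbb{C}^2\to\mathbb{C}^2$ is $\pi_2(z_1,z_2)=(z_1+z_2,z_1z_2)$; the symmetrized bidisc is $\mathbb{G}_2:=\pi_2(\mathbb{D}^2)$, with boundary $\partial\mathbb{G}_2$ in $\mathbb{C}^2$. $f^n$ is the $n$-fold composition of $f$ with itself; the sequences $(n_k)$ are sequences of positive integers tending to infinity. *)

(* Defs.v *)
(* Stdlib reals with Coquelicot; C * C is Coquelicot's normed C-module. *)
From Stdlib Require Import Reals Lra.
From Coquelicot Require Import Coquelicot.

Definition subset {T : Type} (A B : T -> Prop) : Prop := forall x, A x -> B x.

Definition boundary {T : UniformSpace} (D : T -> Prop) (x : T) : Prop :=
  forall V : T -> Prop, locally x V ->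
    (exists y, V y /\ D y) /\ (exists y, V y /\ ~ D y).

(* Complex (C-linear) Fréchet differentiability at every point of [D]. *)
Definition holomorphic_on (D : C * C -> Prop) (f : C * C -> C * C) : Prop :=
  forall z, D z -> ex_filterdiff (K := C_AbsRing) f (locally z).

Definition unit_disc (z : C) : Prop := (Cmod z < 1)%R.

Definition closed_unit_disc (z : C) : Prop := (Cmod z <= 1)%R.

(* e^(i t) *)
Definition cis (t : R) : C := (cos t, sin t).

Definition pi2 (z : C * C) : C * C :=
  ((fst z + snd z)%C, (fst z * snd z)%C).

(* The image of A x B under [pi2]. *)
Definition pi2_image (A B : C -> Prop) (w : C * C) : Prop :=
  exists z1 z2 : C, A z1 /\ B z2 /\ w = pi2 (z1, z2).

Definition G2 : C * C -> Prop := pi2_image unit_disc unit_disc.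

Definition target_at (f : C * C -> C * C) (z0 : C * C) (xi : C * C) : Prop :=
  boundary G2 xi /\
  exists n : nat -> nat,
    (forall k, (0 < n k)%nat) /\
    filterlim n eventually eventually /\
    filterlim (fun k => Nat.iter (n k) f z0) eventually (locally xi).

Definition target (f : C * C -> C * C) (xi : C * C) : Prop :=
  exists z, G2 z /\ target_at f z xi.

Definition royal_circle (w : C * C) : Prop :=
  exists t : R, (0 <= t < 2 * PI)%R /\ w = ((2 * cis t)%C, cis (2 * t)).

Lemma Cmod_cis (t : R) : Cmod (cis t) = 1%R.
Proof.
unfold Cmod, cis; simpl fst; simpl snd.
rewrite <- sqrt_1; f_equal.
generalize (sin2_cos2 t); unfold Rsqr; intros H; simpl; lra.
Qed.

Lemma continuous_pair {T U V : UniformSpace} (f : T -> U) (g : T -> V) (x : T) :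
  continuous f x -> continuous g x -> continuous (fun y => (f y, g y)) x.
Proof.
intros Hf Hg P [e He].
apply (filter_imp (F := locally x) (fun y => ball (f x) e (f y) /\ ball (g x) e (g y))).
- intros y Hy; apply He; exact Hy.
- apply filter_and.
  + apply (Hf (ball (f x) e)); apply locally_ball.
  + apply (Hg (ball (g x) e)); apply locally_ball.
Qed.

Lemma royal_circle_boundary : subset royal_circle (boundary G2).
Proof.
intros w [t [_ ->]] V HV.
assert (E : ((2 * cis t)%C, cis (2 * t)) = pi2 (cis t, cis t)).
{ unfold pi2; simpl; f_equal; [ring|].
  unfold cis, Cmult; simpl; rewrite cos_2a, sin_2a; f_equal; ring. }
split.
- rewrite E in HV.
  set (g := fun r : R => pi2 (Cmult (RtoC r) (cis t), Cmult (RtoC r) (cis t))).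
  assert (Hg : continuous g 1%R).
  { unfold g, pi2, cis, Cmult, Cplus; simpl.
    apply continuous_pair; apply continuous_pair;
      apply (ex_derive_continuous (K := R_AbsRing) (V := R_NormedModule));
      auto_derive; exact I. }
  assert (E1 : g 1%R = pi2 (cis t, cis t)).
  { unfold g; rewrite Cmult_1_l; reflexivity. }
  rewrite <- E1 in HV.
  destruct (Hg V HV) as [e He].
  set (d := Rmin (e / 2) (1 / 2)).
  assert (Hd : (0 < d /\ d < e /\ d <= 1 / 2)%R).
  { assert (H := cond_pos e). unfold d; destruct (Rle_dec (e / 2) (1 / 2)).
    - rewrite Rmin_left by assumption; lra.
    - rewrite Rmin_right by lra; lra. }
  exists (g (1 - d)%R); split.
  + apply He. change (Rabs ((1 - d) - 1) < e)%R.
    replace ((1 - d) - 1)%R with (- d)%R by ring.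
    rewrite Rabs_Ropp, Rabs_pos_eq; lra.
  + assert (Hm : unit_disc (Cmult (RtoC (1 - d)) (cis t))).
    { unfold unit_disc; rewrite Cmod_mult, Cmod_cis, Cmod_R, Rabs_pos_eq; lra. }
    exists (Cmult (RtoC (1 - d)) (cis t)), (Cmult (RtoC (1 - d)) (cis t)).
    split; [exact Hm|split; [exact Hm|reflexivity]].
- eexists; split; [exact (locally_singleton _ _ HV)|].
  intros [z1 [z2 [H1 [H2 H]]]].
  unfold pi2 in H; simpl in H; injection H; intros _ _ Hi Hr.
  assert (Hs : Cmult 2 (cis t) = Cplus z1 z2).
  { apply injective_projections; [exact Hr|exact Hi]. }
  assert (Hm : Cmod (Cmult 2 (cis t)) = 2%R).
  { rewrite Cmod_mult, Cmod_cis, Cmod_R, Rabs_pos_eq; lra. }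
  rewrite Hs in Hm.
  generalize (Cmod_triangle z1 z2).
  unfold unit_disc in H1, H2; lra.
Qed.

(* Main.v *)
Require Import Defs.
From Stdlib Require Import Reals Lra Lia ClassicalEpsilon.
From Coquelicot Require Import Coquelicot.
Local Open Scope R_scope.

(** Two orbits of [f] are compared through holomorphic functions [P] on [G2] with
    nonnegative real part: Harnack's inequality along the slices [t |-> pi2 (t, b)]
    gives [Re P (f^n z) <= K Re P (f^n z0)] with [K] independent of [n] and [P].
    Hence if [f^(n_k) z0 -> eta] and [f^(n_k) z -> xi], then [Re P eta = 0] forces
    [Re P xi = 0], and conversely. For [|lam| = 1] the function [1 - lam s / 2]
    vanishes on the closure of [G2] only at a point of the royal circle, and the
    function equal to half the harmonic mean of [1 - lam a] and [1 - lam b] at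
    [pi2 (a, b)] vanishes at [pi2 (a, b)] when exactly one of [a], [b] is the
    conjugate of [lam], and has positive real part when neither is. Every boundary
    point is a zero of one of these functions, so [eta] lies on the boundary
    whenever [xi] does, and the two assertions follow by the choice of [lam].

    Harnack's inequality for a complex differentiable [g] with [Re g >= 0] on the
    disc comes from the gradient bound [Re (g 0) + Re (g' 0) / 2 >= 0], which is
    Goursat's theorem for [(g (e^w) - g 0) (1 + cosh w)] on a rectangle. *)

(** * Goursat's theorem for closed 1-forms on a rectangle *)

(** [epsilon] picks each successor, and the invariant [B] ensures that one exists. This drives both
    the repeated quartering of a rectangle and the extraction of subsequences. *)
Lemma dependent_choice (T : Type) (B : nat -> T -> Prop) (S' : nat -> T -> T -> Prop) (t0 : T) :
  B 0%nat t0 ->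
  (forall n t, B n t -> exists t', B (S n) t' /\ S' n t t') ->
  exists u : nat -> T,
    u 0%nat = t0 /\ forall n, B n (u n) /\ S' n (u n) (u (S n)).
Proof.
intros H0 Hs.
set (u := fix u n := match n with
  | O => t0
  | S k => epsilon (inhabits t0) (fun t' => B (S k) t' /\ S' k (u k) t')
  end).
assert (HB : forall n, B n (u n)).
{ induction n as [|n IH]; [exact H0|].
  simpl. apply (epsilon_spec (inhabits t0) _ (Hs n (u n) IH)). }
exists u; split; [reflexivity|]; intros n; split; [apply HB|].
apply (epsilon_spec (inhabits t0) _ (Hs n (u n) (HB n))).
Qed.

(** The common point is the supremum of the left endpoints, for which every right endpoint is an
    upper bound. *)
Lemma nested_intervals (a b : nat -> R) :
  (forall n, a n <= b n) -> (forall n, a n <= a (S n)) -> (forall n, b (S n) <= b n) ->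
  exists l, forall n, a n <= l <= b n.
Proof.
intros Hab Ha Hb.
assert (Ha' : forall n k, a n <= a (k + n)%nat).
{ induction k as [|k IH]; simpl; [lra|]. specialize (Ha (k + n)%nat); lra. }
assert (Hb' : forall n k, b (k + n)%nat <= b n).
{ induction k as [|k IH]; simpl; [lra|]. specialize (Hb (k + n)%nat); lra. }
assert (Hm : forall n m, a n <= b m).
{ intros n m. specialize (Ha' n m). specialize (Hb' m n).
  rewrite (Nat.add_comm n m) in Hb'. specialize (Hab (m + n)%nat). lra. }
destruct (completeness (fun x => exists n, x = a n)) as [l [Hl1 Hl2]].
- exists (b 0%nat); intros x [n ->]; apply Hm.
- exists (a 0%nat), 0%nat; reflexivity.
- exists l; intros n; split.
  + apply Hl1; exists n; reflexivity.
  + apply Hl2; intros x [m ->]; apply Hm.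
Qed.

(* The 1-form [P dx + Q dy] is differentiable and closed at [(x0, y0)]: the
   common coefficient [B] is the value of both dP/dy and dQ/dx. *)
Definition closed_form_at (P Q : R -> R -> R) (x0 y0 : R) : Prop :=
  exists A B D : R, forall eps, 0 < eps -> exists d, 0 < d /\
    forall x y, Rabs (x - x0) < d -> Rabs (y - y0) < d ->
      Rabs (P x y - P x0 y0 - A * (x - x0) - B * (y - y0))
        <= eps * (Rabs (x - x0) + Rabs (y - y0)) /\
      Rabs (Q x y - Q x0 y0 - B * (x - x0) - D * (y - y0))
        <= eps * (Rabs (x - x0) + Rabs (y - y0)).

(** The integral of [P dx + Q dy] along the boundary of [[a, b] x [c, d]], counterclockwise. *)
Definition circulation (P Q : R -> R -> R) (a b c d : R) : R :=
  RInt (fun x => P x c) a b + RInt (fun y => Q b y) c d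
  - RInt (fun x => P x d) a b - RInt (fun y => Q a y) c d.

(** Continuity of [P] along horizontals and of [Q] along verticals makes the integrals over the
    sides exist. The estimate with [eps = 1] gives a Lipschitz bound at the point. *)
Lemma closed_form_at_continuous (P Q : R -> R -> R) (x0 y0 : R) :
  closed_form_at P Q x0 y0 ->
  continuous (fun x => P x y0) x0 /\ continuous (fun y => Q x0 y) y0.
Proof.
intros [A [B [D H]]].
assert (L : forall (h : R -> R) (t0 s : R),
  (exists d, 0 < d /\ forall t, Rabs (t - t0) < d ->
     Rabs (h t - h t0 - s * (t - t0)) <= 1 * Rabs (t - t0)) -> continuous h t0).
{ intros h t0 s [d [Hd Hh]].
  apply continuity_pt_filterlim.
  intros e He.
  set (K := Rabs s + 1).
  assert (HK : 0 < K) by (unfold K; generalize (Rabs_pos s); lra).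
  exists (Rmin d (e / K)); split.
  { apply Rmin_glb_lt; [lra|]. apply Rdiv_lt_0_compat; lra. }
  intros t [_ Ht]; unfold dist in *; simpl in *; unfold R_dist in *.
  assert (H1 := Rlt_le_trans _ _ _ Ht (Rmin_l _ _)).
  assert (H2 := Rlt_le_trans _ _ _ Ht (Rmin_r _ _)).
  specialize (Hh t H1).
  assert (H3 : Rabs (h t - h t0) <= K * Rabs (t - t0)).
  { replace (h t - h t0) with ((h t - h t0 - s * (t - t0)) + s * (t - t0)) by ring.
    eapply Rle_trans; [apply Rabs_triang|]. rewrite (Rabs_mult s). unfold K; lra. }
  eapply Rle_lt_trans; [exact H3|].
  apply (Rmult_lt_compat_l K) in H2; [|exact HK].
  replace (K * (e / K)) with e in H2 by (field; lra). exact H2. }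
destruct (H 1 Rlt_0_1) as [d [Hd Hd']].
assert (Z0 : forall z, Rabs (z - z) = 0) by (intros z; rewrite Rminus_diag, Rabs_R0; reflexivity).
split; [apply (L _ _ A)|apply (L _ _ D)]; exists d; (split; [exact Hd|]); intros t Ht.
- destruct (Hd' t y0 Ht) as [H1 _]; [rewrite Z0; exact Hd|].
  rewrite Z0, Rminus_diag, Rplus_0_r, Rmult_0_r, Rminus_0_r in H1. exact H1.
- destruct (Hd' x0 t) as [_ H1]; [rewrite Z0; exact Hd|exact Ht|].
  rewrite Z0, Rminus_diag, Rplus_0_l, Rmult_0_r, Rminus_0_r in H1. exact H1.
Qed.

Section Goursat.

Variables (P Q : R -> R -> R) (a0 b0 c0 d0 : R).
Hypothesis Hcl : forall x y, a0 <= x <= b0 -> c0 <= y <= d0 -> closed_form_at P Q x y.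

Lemma ex_RInt_P (a b y : R) :
  a0 <= a -> a <= b -> b <= b0 -> c0 <= y <= d0 -> ex_RInt (fun x => P x y) a b.
Proof.
intros Ha Hab Hb Hy. apply (ex_RInt_continuous (V := R_CompleteNormedModule)).
rewrite Rmin_left, Rmax_right by lra. intros x Hx.
apply (closed_form_at_continuous P Q x y), Hcl; lra.
Qed.

Lemma ex_RInt_Q (c d x : R) :
  c0 <= c -> c <= d -> d <= d0 -> a0 <= x <= b0 -> ex_RInt (fun y => Q x y) c d.
Proof.
intros Hc Hcd Hd Hx. apply (ex_RInt_continuous (V := R_CompleteNormedModule)).
rewrite Rmin_left, Rmax_right by lra. intros y Hy.
apply (closed_form_at_continuous P Q x y), Hcl; lra.
Qed.

Lemma circulation_split (a b c d m n : R) :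
  a0 <= a -> a <= m -> m <= b -> b <= b0 -> c0 <= c -> c <= n -> n <= d -> d <= d0 ->
  circulation P Q a b c d =
    circulation P Q a m c n + circulation P Q m b c n
    + circulation P Q a m n d + circulation P Q m b n d.
Proof.
intros. unfold circulation.
assert (CP : forall y, c0 <= y <= d0 ->
  RInt (fun x => P x y) a b = RInt (fun x => P x y) a m + RInt (fun x => P x y) m b).
{ intros y Hy. symmetry. apply (RInt_Chasles (fun x => P x y)); apply ex_RInt_P; lra. }
assert (CQ : forall x, a0 <= x <= b0 ->
  RInt (fun y => Q x y) c d = RInt (fun y => Q x y) c n + RInt (fun y => Q x y) n d).
{ intros x Hx. symmetry. apply (RInt_Chasles (fun y => Q x y)); apply ex_RInt_Q; lra. }
rewrite (CP c), (CP d), (CQ b), (CQ a) by lra. ring.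
Qed.

(** Serves to compare opposite sides of a rectangle, [s] being the difference predicted by the
    linear approximation. *)
Lemma RInt_difference_bound (h k : R -> R) (a b s M : R) :
  a <= b -> ex_RInt h a b -> ex_RInt k a b ->
  (forall t, a <= t <= b -> Rabs (h t - k t - s) <= M) ->
  Rabs (RInt h a b - RInt k a b - s * (b - a)) <= (b - a) * M.
Proof.
intros Hab Hh Hk HM.
assert (Hm : ex_RInt (fun t => minus (h t) (k t)) a b)
  by (apply (ex_RInt_minus (V := R_NormedModule)); assumption).
assert (Hc : ex_RInt (fun _ : R => s) a b) by apply (ex_RInt_const (V := R_NormedModule)).
replace (RInt h a b - RInt k a b - s * (b - a))
  with (RInt (fun t => minus (minus (h t) (k t)) s) a b).
- apply abs_RInt_le_const; [exact Hab| |exact HM].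
  apply (ex_RInt_minus (V := R_NormedModule)); assumption.
- rewrite (RInt_minus (V := R_CompleteNormedModule)) by assumption.
  rewrite (RInt_minus (V := R_CompleteNormedModule)) by assumption.
  rewrite RInt_const. unfold minus, plus, opp, scal; simpl. unfold mult; simpl. ring.
Qed.

(** The linear approximation contributes [B (c - d) (b - a)] on the horizontal sides and
    [B (b - a) (d - c)] on the vertical ones; these cancel because the form is closed. Only the
    remainder is left. *)
Lemma circulation_small (x0 y0 E : R) :
  a0 <= x0 <= b0 -> c0 <= y0 <= d0 -> 0 < E ->
  exists r, 0 < r /\ forall a b c d,
    a0 <= a -> a <= x0 <= b -> b <= b0 -> c0 <= c -> c <= y0 <= d -> d <= d0 ->
    b - a < r -> d - c < r ->
    Rabs (circulation P Q a b c d) <= E * ((b - a) + (d - c)) ^ 2.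
Proof.
intros Hx Hy HE.
destruct (Hcl x0 y0 Hx Hy) as [A [B [D H]]].
(* Half of [E], because the remainder enters once for each of two opposite sides. *)
destruct (H (E / 2)) as [r [Hr Hr']]; [lra|].
exists r; split; [exact Hr|].
intros a b c d Ha Hx0 Hb Hc Hy0 Hd Hp Hq.
assert (Key : forall x y, a <= x <= b -> c <= y <= d ->
      Rabs (P x y - P x0 y0 - A * (x - x0) - B * (y - y0)) <= E / 2 * ((b - a) + (d - c)) /\
      Rabs (Q x y - Q x0 y0 - B * (x - x0) - D * (y - y0)) <= E / 2 * ((b - a) + (d - c))).
{ intros x y Hx1 Hy1.
  assert (X : Rabs (x - x0) <= b - a) by (apply Rabs_le; lra).
  assert (Y : Rabs (y - y0) <= d - c) by (apply Rabs_le; lra).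
  destruct (Hr' x y) as [K1 K2]; [lra|lra|].
  assert (E / 2 * (Rabs (x - x0) + Rabs (y - y0)) <= E / 2 * ((b - a) + (d - c)))
    by (apply Rmult_le_compat_l; lra).
  lra. }
assert (IP : Rabs (RInt (fun x => P x c) a b - RInt (fun x => P x d) a b - (B * (c - d)) * (b - a))
   <= (b - a) * (E * ((b - a) + (d - c)))).
{ apply RInt_difference_bound; [lra|apply ex_RInt_P; lra|apply ex_RInt_P; lra|].
  intros t Ht. destruct (Key t c) as [K1 _]; [lra|lra|]. destruct (Key t d) as [K2 _]; [lra|lra|].
  apply Rabs_le_between in K1. apply Rabs_le_between in K2. apply Rabs_le. lra. }
assert (IQ : Rabs (RInt (fun y => Q b y) c d - RInt (fun y => Q a y) c d - (B * (b - a)) * (d - c))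
   <= (d - c) * (E * ((b - a) + (d - c)))).
{ apply RInt_difference_bound; [lra|apply ex_RInt_Q; lra|apply ex_RInt_Q; lra|].
  intros t Ht. destruct (Key b t) as [_ K1]; [lra|lra|]. destruct (Key a t) as [_ K2]; [lra|lra|].
  apply Rabs_le_between in K1. apply Rabs_le_between in K2. apply Rabs_le. lra. }
unfold circulation.
apply Rabs_le_between in IP. apply Rabs_le_between in IQ. apply Rabs_le. lra.
Qed.

(** Of the four quarters of a rectangle, one keeps at least a quarter of the circulation. The nested
    quarters shrink to a point, where [circulation_small] contradicts a nonzero circulation. *)
Lemma goursat : a0 <= b0 -> c0 <= d0 -> circulation P Q a0 b0 c0 d0 = 0.
Proof.
intros Hab Hcd.
destruct (Req_dec (circulation P Q a0 b0 c0 d0) 0) as [|Hne]; [assumption|exfalso].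
assert (HE := Rabs_pos_lt _ Hne).
set (E := Rabs (circulation P Q a0 b0 c0 d0)) in HE.
set (p := fun n => (b0 - a0) * (/ 2) ^ n).
set (q := fun n => (d0 - c0) * (/ 2) ^ n).
assert (Hpow : forall n, 0 < (/ 2) ^ n) by (intros n; apply pow_lt; lra).
assert (Hp0 : forall n, 0 <= p n) by (intros n; apply Rmult_le_pos; [lra|left; apply Hpow]).
assert (Hq0 : forall n, 0 <= q n) by (intros n; apply Rmult_le_pos; [lra|left; apply Hpow]).
assert (HpS : forall n, p n = p (S n) + p (S n)) by (intros n; unfold p; simpl; field).
assert (HqS : forall n, q n = q (S n) + q (S n)) by (intros n; unfold q; simpl; field).
(* The state is the lower left corner; the side lengths [p n] and [q n] depend on the stage only. *)
destruct (dependent_choice (R * R)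
  (fun n s => a0 <= fst s /\ fst s + p n <= b0 /\ c0 <= snd s /\ snd s + q n <= d0 /\
     E * (/ 4) ^ n <= Rabs (circulation P Q (fst s) (fst s + p n) (snd s) (snd s + q n)))
  (fun n s t => fst s <= fst t /\ fst t + p (S n) <= fst s + p n /\
                snd s <= snd t /\ snd t + q (S n) <= snd s + q n)
  (a0, c0)) as [u [_ Hu]].
- simpl. replace (a0 + p 0%nat) with b0 by (unfold p; simpl; ring).
  replace (c0 + q 0%nat) with d0 by (unfold q; simpl; ring).
  fold E. lra.
- intros n [x y]; simpl fst; simpl snd. intros [H1 [H2 [H3 [H4 H5]]]].
  assert (P1 := Hp0 (S n)). assert (Q1 := Hq0 (S n)).
  assert (P2 := HpS n). assert (Q2 := HqS n).
  rewrite (circulation_split x (x + p n) y (y + q n) (x + p (S n)) (y + q (S n))) in H5 by lra.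
  replace (E * (/ 4) ^ n) with (4 * (E * (/ 4) ^ S n)) in H5 by (simpl; field).
  replace (x + p n) with (x + p (S n) + p (S n)) in * by lra.
  replace (y + q n) with (y + q (S n) + q (S n)) in * by lra.
  (* If three quarters fall short of the required share, the fourth cannot. *)
  match type of H5 with _ <= Rabs (?A + ?B + ?C + ?D) =>
    assert (T : Rabs (A + B + C + D) <= Rabs A + Rabs B + Rabs C + Rabs D);
    [ generalize (Rabs_triang (A + B + C) D) (Rabs_triang (A + B) C) (Rabs_triang A B); lra|];
    destruct (Rle_dec (E * (/ 4) ^ S n) (Rabs A));
    [ exists (x, y)
    | destruct (Rle_dec (E * (/ 4) ^ S n) (Rabs B));
      [ exists (x + p (S n), y)
      | destruct (Rle_dec (E * (/ 4) ^ S n) (Rabs C));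
        [ exists (x, y + q (S n))
        | exists (x + p (S n), y + q (S n)) ]]]
  end; simpl fst; simpl snd; repeat split; try lra.
- destruct (nested_intervals (fun n => fst (u n)) (fun n => fst (u n) + p n)) as [x0 Hx0].
  { intros n; specialize (Hp0 n); lra. }
  { intros n; apply (Hu n). } { intros n; apply (Hu n). }
  destruct (nested_intervals (fun n => snd (u n)) (fun n => snd (u n) + q n)) as [y0 Hy0].
  { intros n; specialize (Hq0 n); lra. }
  { intros n; apply (Hu n). } { intros n; apply (Hu n). }
  set (S2 := (b0 - a0) + (d0 - c0)).
  assert (HS2 : 0 <= S2) by (unfold S2; lra).
  assert (HS3 : 0 < 2 * S2 ^ 2 + 1) by nra.
  (* This tolerance times [S2 ^ 2] is less than [E], and the denominator is positive even if
     [S2 = 0]. *)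
  destruct (circulation_small x0 y0 (E / (2 * S2 ^ 2 + 1))) as [r [Hr Hr']].
  { destruct (Hu 0%nat) as [[? [? _]] _]. specialize (Hx0 0%nat). lra. }
  { destruct (Hu 0%nat) as [[_ [_ [? [? _]]]] _]. specialize (Hy0 0%nat). lra. }
  { apply Rdiv_lt_0_compat; lra. }
  assert (Hn : exists n, S2 * (/ 2) ^ n < r).
  { destruct (pow_lt_1_zero (/ 2)) with (y := r / (S2 + 1)) as [N HN].
    - rewrite Rabs_pos_eq; lra.
    - apply Rdiv_lt_0_compat; lra.
    - exists N. specialize (HN N (le_n _)). rewrite Rabs_pos_eq in HN by (left; apply Hpow).
      apply (Rmult_lt_compat_l (S2 + 1)) in HN; [|lra].
      replace ((S2 + 1) * (r / (S2 + 1))) with r in HN by (field; lra).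
      specialize (Hpow N). lra. }
  destruct Hn as [n Hn].
  destruct (Hu n) as [[H1 [H2 [H3 [H4 H5]]]] _].
  assert (Hpq : S2 * (/ 2) ^ n = p n + q n) by (unfold S2, p, q; ring).
  specialize (Hp0 n); specialize (Hq0 n).
  specialize (Hr' (fst (u n)) (fst (u n) + p n) (snd (u n)) (snd (u n) + q n)
    H1 (Hx0 n) H2 H3 (Hy0 n) H4).
  assert (Hc := Rle_trans _ _ _ H5 (Hr' ltac:(lra) ltac:(lra))).
  replace (fst (u n) + p n - fst (u n) + (snd (u n) + q n - snd (u n)))
    with (S2 * (/ 2) ^ n) in Hc by lra.
  replace ((S2 * (/ 2) ^ n) ^ 2) with (S2 ^ 2 * (/ 4) ^ n) in Hc.
  2:{ rewrite Rpow_mult_distr, <- pow_mult, Nat.mul_comm, pow_mult.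
      do 2 f_equal. field. }
  assert (H4n : 0 < (/ 4) ^ n) by (apply pow_lt; lra).
  assert (Hlt : E / (2 * S2 ^ 2 + 1) * S2 ^ 2 < E).
  { apply (Rmult_lt_reg_r (2 * S2 ^ 2 + 1)); [lra|].
    replace (E / (2 * S2 ^ 2 + 1) * S2 ^ 2 * (2 * S2 ^ 2 + 1)) with (E * S2 ^ 2) by (field; lra).
    apply Rmult_lt_compat_l; nra. }
  apply (Rmult_lt_compat_r _ _ _ H4n) in Hlt. lra.
Qed.

End Goursat.

(** * Complex derivatives and the exponential *)

Definition C_der (g : C -> C) (z l : C) : Prop :=
  is_derive (K := C_AbsRing) (V := AbsRing_NormedModule C_AbsRing) g z l.

Lemma C_der_iff (g : C -> C) (z l : C) :
  C_der g z l <->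
  forall eps, 0 < eps -> exists d, 0 < d /\ forall w, Cmod (w - z)%C < d ->
    Cmod (g w - g z - (w - z) * l)%C <= eps * Cmod (w - z)%C.
Proof.
split.
- intros [_ H] eps He.
  destruct (H z (fun P HP => HP) (mkposreal eps He)) as [d Hd].
  exists d; split; [apply cond_pos|]. intros w Hw. exact (Hd w Hw).
- intros H. split; [apply is_linear_scal_l|].
  intros x Hx.
  apply (is_filter_lim_locally_unique (K := C_AbsRing) (V := AbsRing_NormedModule C_AbsRing)) in Hx.
  subst x.
  intros [eps He]. destruct (H eps He) as [d [Hd Hd']].
  exists (mkposreal d Hd). intros w Hw. exact (Hd' w Hw).
Qed.

Lemma C_der_ext (g h : C -> C) (z l : C) :
  (forall t, g t = h t) -> C_der g z l -> C_der h z l.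
Proof. exact (is_derive_ext (K := C_AbsRing) (V := AbsRing_NormedModule C_AbsRing) g h z l). Qed.

Lemma C_der_const (a z : C) : C_der (fun _ => a) z 0.
Proof. exact (is_derive_const (K := C_AbsRing) (V := AbsRing_NormedModule C_AbsRing) a z). Qed.

Lemma C_der_id (z : C) : C_der (fun w => w) z 1.
Proof. exact (is_derive_id (K := C_AbsRing) z). Qed.

Lemma C_der_plus (g h : C -> C) (z l m : C) :
  C_der g z l -> C_der h z m -> C_der (fun w => (g w + h w)%C) z (l + m)%C.
Proof. exact (is_derive_plus (K := C_AbsRing) (V := AbsRing_NormedModule C_AbsRing) g h z l m). Qed.

Lemma C_der_minus (g h : C -> C) (z l m : C) :
  C_der g z l -> C_der h z m -> C_der (fun w => (g w - h w)%C) z (l - m)%C.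
Proof. exact (is_derive_minus (K := C_AbsRing) (V := AbsRing_NormedModule C_AbsRing) g h z l m). Qed.

Lemma C_der_opp (g : C -> C) (z l : C) : C_der g z l -> C_der (fun w => (- g w)%C) z (- l)%C.
Proof. exact (is_derive_opp (K := C_AbsRing) (V := AbsRing_NormedModule C_AbsRing) g z l). Qed.

Lemma C_der_mult (g h : C -> C) (z l m : C) :
  C_der g z l -> C_der h z m -> C_der (fun w => (g w * h w)%C) z (l * h z + g z * m)%C.
Proof.
intros Hg Hh.
exact (is_derive_mult (K := C_AbsRing) g h z l m Hg Hh Cmult_comm).
Qed.

Lemma C_der_comp (g h : C -> C) (z l m : C) :
  C_der g (h z) l -> C_der h z m -> C_der (fun w => g (h w)) z (m * l)%C.
Proof.
intros Hg Hh.
exact (is_derive_comp (K := C_AbsRing) (V := AbsRing_NormedModule C_AbsRing) g h z l m Hg Hh).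
Qed.

Lemma Cmod_minus_sym (a b : C) : Cmod (a - b)%C = Cmod (b - a)%C.
Proof. rewrite <- Cmod_opp. f_equal. ring. Qed.

Lemma Cmod_triangle_rev (a b : C) : Cmod a - Cmod b <= Cmod (a - b)%C.
Proof.
generalize (Cmod_triangle (a - b)%C b). replace (a - b + b)%C with a by ring. lra.
Qed.

(** The remainder of the linear approximation equals [(w - z)^2 / (z^2 w)]. *)
Lemma C_der_inv (z : C) : z <> 0%C -> C_der Cinv z (- / (z * z))%C.
Proof.
intros Hz. apply C_der_iff. intros eps He.
assert (Hm : 0 < Cmod z) by (apply Cmod_gt_0; exact Hz).
set (M := Cmod z) in *.
(* The first bound keeps [Cmod w] above [M / 2], so the denominator is at least [M ^ 3 / 2] in
   modulus; the second absorbs one factor [w - z]. *)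
exists (Rmin (M / 2) (eps * M ^ 3 / 2)); split.
{ apply Rmin_glb_lt; [lra|]. assert (0 < M ^ 3) by (apply pow_lt; lra). nra. }
intros w Hw.
assert (H1 := Rlt_le_trans _ _ _ Hw (Rmin_l _ _)).
assert (H2 := Rlt_le_trans _ _ _ Hw (Rmin_r _ _)).
assert (Hwm : M / 2 < Cmod w).
{ generalize (Cmod_triangle_rev z w). rewrite Cmod_minus_sym. fold M. lra. }
assert (Hw0 : w <> 0%C) by (apply Cmod_gt_0; lra).
replace (/ w - / z - (w - z) * - / (z * z))%C
  with ((w - z) * (w - z) / (z * z * w))%C by (field; split; assumption).
assert (Hd : (z * z * w)%C <> 0%C) by (repeat apply Cmult_neq_0; assumption).
rewrite Cmod_div, !Cmod_mult by assumption. fold M.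
set (r := Cmod (w - z)%C) in *.
assert (Hr : 0 <= r) by apply Cmod_ge_0.
assert (HW : M ^ 3 / 2 <= M * M * Cmod w) by (simpl; nra).
assert (H3 : 0 < M ^ 3) by (apply pow_lt; lra).
apply (Rmult_le_reg_r (M * M * Cmod w)); [lra|].
replace (r * r / (M * M * Cmod w) * (M * M * Cmod w)) with (r * r) by (field; split; lra).
apply Rle_trans with (r * (eps * M ^ 3 / 2)); [apply Rmult_le_compat_l; lra|].
replace (eps * r * (M * M * Cmod w)) with (r * (eps * (M * M * Cmod w))) by ring.
apply Rmult_le_compat_l; [exact Hr|]. nra.
Qed.

Lemma C_der_div (g h : C -> C) (z l m : C) :
  h z <> 0%C -> C_der g z l -> C_der h z m -> exists k, C_der (fun w => (g w / h w)%C) z k.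
Proof.
intros Hz Hg Hh. eexists.
apply (C_der_mult g (fun w => / h w)%C); [exact Hg|].
apply (C_der_comp Cinv h); [apply C_der_inv; exact Hz|exact Hh].
Qed.

(** * The complex exponential *)

Definition cexp (w : C) : C := (exp (fst w) * cis (snd w))%C.

Lemma cexp_plus (w h : C) : cexp (w + h)%C = (cexp w * cexp h)%C.
Proof.
destruct w as [x y], h as [u v]. unfold cexp, cis, Cmult, RtoC, Cplus; simpl.
rewrite exp_plus, cos_plus, sin_plus. f_equal; ring.
Qed.

Lemma Cmod_cexp (w : C) : Cmod (cexp w) = exp (fst w).
Proof.
unfold cexp. rewrite Cmod_mult, Cmod_cis, Cmod_R, Rmult_1_r.
apply Rabs_pos_eq. left; apply exp_pos.
Qed.

Lemma cexp_opp (w : C) : (cexp w * cexp (- w) = 1)%C.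
Proof.
rewrite <- cexp_plus. replace (w + - w)%C with (RtoC 0) by ring.
unfold cexp, cis; simpl. rewrite exp_0, cos_0, sin_0. unfold RtoC, Cmult; simpl. f_equal; ring.
Qed.

Lemma is_derive_at_0 (h : R -> R) (l eps : R) :
  is_derive h 0 l -> 0 < eps -> exists d, 0 < d /\ forall x, Rabs x < d ->
    Rabs (h x - h 0 - l * x) <= eps * Rabs x.
Proof.
intros [_ H] He.
destruct (H 0 (fun P HP => HP) (mkposreal eps He)) as [d Hd].
exists d; split; [apply cond_pos|]. intros x Hx.
specialize (Hd x).
assert (Hb : ball 0 d x).
{ change (Rabs (x - 0) < d). rewrite Rminus_0_r; exact Hx. }
specialize (Hd Hb).
change (Rabs (h x - h 0 - (x - 0) * l) <= eps * Rabs (x - 0)) in Hd.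
rewrite Rminus_0_r in Hd. rewrite (Rmult_comm l). exact Hd.
Qed.

(** Real and imaginary parts are expanded to first order by means of the real derivatives of [exp],
    [cos] and [sin] at 0. *)
Lemma C_der_cexp_0 : C_der cexp 0 1.
Proof.
apply C_der_iff. intros eps He.
(* The real part costs [3 e r] and the imaginary part [5 e r], which explains the 8. *)
set (e := Rmin (eps / 8) 1).
assert (He0 : 0 < e) by (apply Rmin_glb_lt; lra).
assert (He1 : e <= eps / 8) by apply Rmin_l.
assert (He2 : e <= 1) by apply Rmin_r. clearbody e.
destruct (is_derive_at_0 exp 1 e) as [d1 [D1 E1]]; [|exact He0|].
{ generalize (is_derive_exp 0). rewrite exp_0. auto. }
destruct (is_derive_at_0 cos 0 e) as [d2 [D2 E2]]; [|exact He0|].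
{ generalize (is_derive_cos 0). rewrite sin_0, Ropp_0. auto. }
destruct (is_derive_at_0 sin 1 e) as [d3 [D3 E3]]; [|exact He0|].
{ generalize (is_derive_sin 0). rewrite cos_0. auto. }
set (d := Rmin (Rmin d1 d2) (Rmin d3 e)).
exists d; split.
{ repeat apply Rmin_glb_lt; assumption. }
intros [x y] Hw.
replace ((x, y) - 0)%C with ((x, y) : C) in *
  by (unfold RtoC, Cminus, Cplus, Copp; simpl; f_equal; ring).
assert (Hx : Rabs x <= Cmod (x, y)) by (apply (re_le_Cmod (x, y))).
assert (Hy : Rabs y <= Cmod (x, y)).
{ eapply Rle_trans; [|apply Rmax_Cmod]. apply Rmax_r. }
set (r := Cmod (x, y)) in *.
assert (d <= d1) by (eapply Rle_trans; [apply Rmin_l|apply Rmin_l]).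
assert (d <= d2) by (eapply Rle_trans; [apply Rmin_l|apply Rmin_r]).
assert (d <= d3) by (eapply Rle_trans; [apply Rmin_r|apply Rmin_l]).
assert (d <= e) by (eapply Rle_trans; [apply Rmin_r|apply Rmin_r]).
specialize (E1 x ltac:(lra)). specialize (E2 y ltac:(lra)). specialize (E3 y ltac:(lra)).
rewrite exp_0 in E1. rewrite cos_0 in E2. rewrite sin_0 in E3.
assert (Hr : 0 <= r) by apply Cmod_ge_0.
assert (F1 : Rabs (exp x - 1 - 1 * x) <= e * r) by nra.
assert (F2 : Rabs (cos y - 1 - 0 * y) <= e * r) by nra.
assert (F3 : Rabs (sin y - 0 - 1 * y) <= e * r) by nra.
assert (Re1 : Rabs (exp x * cos y - 1 - x) <= 3 * (e * r)).
{ replace (exp x * cos y - 1 - x) with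
    ((exp x - 1 - 1 * x) * cos y + (1 + x) * (cos y - 1 - 0 * y)) by ring.
  eapply Rle_trans; [apply Rabs_triang|]. rewrite !Rabs_mult.
  assert (C1 : Rabs (cos y) <= 1) by (apply Rabs_le; generalize (COS_bound y); lra).
  assert (C2 : Rabs (1 + x) <= 2).
  { eapply Rle_trans; [apply Rabs_triang|]. rewrite Rabs_R1; lra. }
  assert (P1 := Rabs_pos (cos y)). assert (P2 := Rabs_pos (1 + x)).
  assert (P3 := Rabs_pos (exp x - 1 - 1 * x)). assert (P4 := Rabs_pos (cos y - 1 - 0 * y)).
  nra. }
assert (Im1 : Rabs (exp x * sin y - y) <= 5 * (e * r)).
{ replace (exp x * sin y - y) with
    (exp x * (sin y - 0 - 1 * y) + (exp x - 1 - 1 * x) * y + x * y) by ring.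
  assert (X3 : Rabs (exp x) <= 3).
  { apply Rabs_le_between in F1. assert (Hx' := Hx). apply Rabs_le_between in Hx'.
    assert (e * r <= 1) by nra.
    rewrite Rabs_pos_eq by (left; apply exp_pos). lra. }
  assert (T1 := Rabs_triang (exp x * (sin y - 0 - 1 * y) + (exp x - 1 - 1 * x) * y) (x * y)).
  assert (T2 := Rabs_triang (exp x * (sin y - 0 - 1 * y)) ((exp x - 1 - 1 * x) * y)).
  rewrite !Rabs_mult in *.
  assert (P1 := Rabs_pos x). assert (P2 := Rabs_pos y). assert (P0 := Rabs_pos (exp x)).
  assert (P3 := Rabs_pos (exp x - 1 - 1 * x)). assert (P4 := Rabs_pos (sin y - 0 - 1 * y)).
  assert (Rabs (exp x) * Rabs (sin y - 0 - 1 * y) <= 3 * (e * r))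
    by (apply Rmult_le_compat; assumption).
  assert (Rabs (exp x - 1 - 1 * x) * Rabs y <= (e * r) * 1)
    by (apply Rmult_le_compat; lra).
  assert (Rabs x * Rabs y <= r * e) by (apply Rmult_le_compat; lra).
  lra. }
replace (cexp (x, y) - cexp 0 - (x, y) * 1)%C
  with ((RtoC (exp x * cos y - 1 - x) + Ci * RtoC (exp x * sin y - y))%C).
2:{ unfold cexp, cis, RtoC, Cmult, Cminus, Cplus, Copp, Ci; simpl.
    rewrite exp_0, cos_0, sin_0. f_equal; ring. }
eapply Rle_trans; [apply Cmod_triangle|].
rewrite Cmod_mult, Cmod_Ci, !Cmod_R.
nra.
Qed.

(** The functional equation carries the derivative at 0 to [w], with the error scaled by
    [Cmod (cexp w) = exp (fst w)]. *)
Lemma C_der_cexp (w : C) : C_der cexp w (cexp w).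
Proof.
apply C_der_iff. intros eps He.
destruct (proj1 (C_der_iff _ _ _) C_der_cexp_0 (eps / exp (fst w))) as [d [Hd H]].
{ apply Rdiv_lt_0_compat; [exact He|apply exp_pos]. }
exists d; split; [exact Hd|]. intros v Hv.
assert (H0 : cexp 0 = 1%C).
{ unfold cexp, cis; simpl. rewrite exp_0, cos_0, sin_0.
  unfold RtoC, Cmult; simpl. f_equal; ring. }
specialize (H (v - w)%C).
replace (v - w - 0)%C with (v - w)%C in H by ring. specialize (H Hv).
rewrite H0 in H.
replace (cexp v) with (cexp w * cexp (v - w))%C.
2:{ rewrite <- cexp_plus. f_equal; ring. }
replace (cexp w * cexp (v - w) - cexp w - (v - w) * cexp w)%C
  with (cexp w * (cexp (v - w) - 1 - (v - w) * 1))%C by ring.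
rewrite Cmod_mult, Cmod_cexp.
replace (eps * Cmod (v - w)%C) with (exp (fst w) * (eps / exp (fst w) * Cmod (v - w)%C)).
- apply Rmult_le_compat_l; [left; apply exp_pos|exact H].
- field. apply Rgt_not_eq, exp_pos.
Qed.

(* The Cauchy-Riemann equations make [Im (G dz) = Im G dx + Re G dy] closed. *)
Lemma C_der_closed_form (G : C -> C) (x0 y0 : R) (l : C) :
  C_der G (x0, y0) l ->
  closed_form_at (fun x y => Im (G (x, y))) (fun x y => Re (G (x, y))) x0 y0.
Proof.
intros H. exists (Im l), (Re l), (- Im l). intros eps He.
destruct (proj1 (C_der_iff _ _ _) H eps He) as [d [Hd Hd']].
exists (d / 2); split; [lra|]. intros x y Hx Hy.
set (w := ((x, y) - (x0, y0))%C : C).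
assert (Hw : Cmod w <= Rabs (x - x0) + Rabs (y - y0)).
{ replace w with (RtoC (x - x0) + Ci * RtoC (y - y0))%C.
  - eapply Rle_trans; [apply Cmod_triangle|].
    rewrite Cmod_mult, Cmod_Ci, !Cmod_R; lra.
  - unfold w, RtoC, Ci, Cmult, Cminus, Cplus, Copp; simpl; f_equal; ring. }
specialize (Hd' (x, y)). fold w in Hd'. specialize (Hd' ltac:(lra)).
assert (Hb : eps * Cmod w <= eps * (Rabs (x - x0) + Rabs (y - y0)))
  by (apply Rmult_le_compat_l; lra).
assert (H1 := re_le_Cmod (G (x, y) - G (x0, y0) - w * l)%C).
assert (H2 := Rmax_Cmod (G (x, y) - G (x0, y0) - w * l)%C).
assert (H3 := Rmax_r (Rabs (fst (G (x, y) - G (x0, y0) - w * l)%C))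
                (Rabs (snd (G (x, y) - G (x0, y0) - w * l)%C))).
split.
- match goal with |- Rabs ?A <= _ =>
    replace A with (snd (G (x, y) - G (x0, y0) - w * l)%C) end; [lra|].
  unfold w, Cminus, Cplus, Copp, Cmult, Im, Re; simpl; ring.
- match goal with |- Rabs ?A <= _ =>
    replace A with (Re (G (x, y) - G (x0, y0) - w * l)%C) end; [lra|].
  unfold w, Cminus, Cplus, Copp, Cmult, Im, Re; simpl; ring.
Qed.

(** * Harnack's inequality on the disc *)

(** Periodicity, here and in the next lemma, makes the horizontal sides of the rectangle of height
    [2 * PI] cancel. *)
Lemma cexp_2PI (x : R) : cexp (x, 2 * PI)%R = cexp (x, 0).
Proof. unfold cexp, cis; simpl. rewrite cos_2PI, sin_2PI, cos_0, sin_0. reflexivity. Qed.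

Lemma cexp_opp_2PI (x : R) : cexp (- (x, 2 * PI)%R)%C = cexp (- (x, 0))%C.
Proof.
unfold cexp, cis, Copp; simpl.
rewrite Ropp_0, cos_neg, sin_neg, cos_2PI, sin_2PI, Ropp_0, cos_0, sin_0. reflexivity.
Qed.

Lemma RInt_one_plus_cos (a : R) : RInt (fun y => a * (1 + cos y)) 0 (2 * PI) = a * (2 * PI).
Proof.
apply is_RInt_unique.
replace (a * (2 * PI)) with (minus (a * (2 * PI + sin (2 * PI))) (a * (0 + sin 0))).
- apply (is_RInt_derive (fun y => a * (y + sin y))).
  + intros x _. auto_derive; [exact I|ring].
  + intros x _. apply (ex_derive_continuous (K := R_AbsRing) (V := R_NormedModule)).
    auto_derive; exact I.
- rewrite sin_2PI, sin_0. unfold minus, plus, opp; simpl. ring.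
Qed.

(* On the circle [|z| = 1] the weight [1 + (z + 1/z) / 2 = 1 + cos t] is nonnegative,
   and the mean of [(g z - g 0) * (1 + (z + 1/z) / 2)] over [|z| = r] does not depend
   on [r]; it tends to [l / 2] as [r -> 0]. *)
Lemma positive_real_part_derivative (g : C -> C) (l : C) :
  (forall z, Cmod z <= 1 -> exists m, C_der g z m) ->
  (forall z, Cmod z <= 1 -> 0 <= Re (g z)) ->
  C_der g 0 l -> 0 <= Re (g 0) + Re l / 2.
Proof.
intros Hd Hp Hl.
destruct (Rle_dec 0 (Re (g 0) + Re l / 2)) as [|Hneg]; [assumption|exfalso].
(* The sum to be shown nonnegative is [- 5 eps], so an error of [4 eps] still leaves it negative. *)
set (eps := - (Re (g 0) + Re l / 2) / 5).
assert (He : 0 < eps) by (unfold eps; lra).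
destruct (proj1 (C_der_iff _ _ _) Hl eps He) as [d [Hd0 Hd1]].
assert (Hm : 0 <= Cmod l) by apply Cmod_ge_0.
(* The radius of the inner circle: the derivative estimate applies on it, it is at most 1, and
   [rho * Cmod l <= eps]. *)
set (rho := Rmin (Rmin (d / 2) 1) (eps / (Cmod l + 1))).
assert (Hrho : 0 < rho).
{ apply Rmin_glb_lt; [apply Rmin_glb_lt; lra|apply Rdiv_lt_0_compat; lra]. }
assert (Hrd : rho < d).
{ apply Rle_lt_trans with (d / 2); [|lra]. eapply Rle_trans; apply Rmin_l. }
assert (Hr1 : rho <= 1) by (eapply Rle_trans; [apply Rmin_l|apply Rmin_r]).
assert (Hrl : rho * Cmod l <= eps).
{ apply Rle_trans with (eps / (Cmod l + 1) * (Cmod l + 1)); [|right; field; lra].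
  apply Rmult_le_compat; [lra|lra|apply Rmin_r|lra]. }
clearbody rho.
set (x0 := ln rho).
assert (Hx0 : exp x0 = rho) by (apply exp_ln; exact Hrho).
assert (Hx0n : x0 <= 0).
{ unfold x0. rewrite <- ln_1. apply ln_le; lra. }
assert (HPI := PI_RGT_0).
(* In the coordinate [w = log z] the annulus [rho <= |z| <= 1] becomes the rectangle [[x0, 0] x
   [0, 2 PI]], and [dz / z] becomes [dw]. *)
set (G := fun w => ((g (cexp w) - g 0) * (1 + (cexp w + cexp (- w)) / 2))%C).
assert (HG : forall x y, x <= 0 -> exists m, C_der G (x, y) m).
{ intros x y Hx.
  destruct (Hd (cexp (x, y))) as [m Hm'].
  { rewrite Cmod_cexp; simpl. rewrite <- exp_0.
    destruct Hx as [Hx|Hx]; [left; apply exp_increasing; exact Hx|right; rewrite Hx; reflexivity]. }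
  assert (Hneg' := C_der_opp (fun w => w) (x, y) 1%C (C_der_id _)).
  eexists. unfold G. apply C_der_mult.
  - apply C_der_minus; [|apply C_der_const].
    apply (C_der_comp g cexp); [exact Hm'|apply C_der_cexp].
  - apply C_der_plus; [apply C_der_const|].
    apply C_der_mult; [|apply C_der_const].
    apply C_der_plus; [apply C_der_cexp|].
    apply (C_der_comp cexp (fun w => (- w)%C)); [apply C_der_cexp|exact Hneg']. }
assert (Hcl : forall x y, x0 <= x <= 0 -> 0 <= y <= 2 * PI ->
   closed_form_at (fun x y => Im (G (x, y))) (fun x y => Re (G (x, y))) x y).
{ intros x y [_ Hx] _. destruct (HG x y Hx) as [m Hm']. apply (C_der_closed_form G x y m Hm'). }
assert (HC := goursat _ _ x0 0 0 (2 * PI) Hcl Hx0n ltac:(lra)).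
unfold circulation in HC.
(* With the horizontal sides equal, the integrals over the two vertical sides, that is over the two
   circles, agree. *)
rewrite (RInt_ext (fun x => Im (G (x, 2 * PI)%R)) (fun x => Im (G (x, 0)))) in HC.
2:{ intros x _. unfold G. rewrite cexp_2PI, cexp_opp_2PI. reflexivity. }
assert (HQ : forall x, x0 <= x <= 0 -> ex_RInt (fun y => Re (G (x, y))) 0 (2 * PI)).
{ intros x Hx. apply (ex_RInt_Q _ _ x0 0 0 (2 * PI) Hcl); lra. }
(* On the unit circle the weight is [1 + cos y >= 0] and [Re g >= 0], so only the contribution of
   [- g 0] is kept. *)
assert (Hlow : - Re (g 0) * (2 * PI) <= RInt (fun y => Re (G (0, y))) 0 (2 * PI)).
{ rewrite <- RInt_one_plus_cos. apply RInt_le; [lra| |apply HQ; lra|].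
  - apply (ex_RInt_continuous (V := R_CompleteNormedModule)). intros x _.
    apply (ex_derive_continuous (K := R_AbsRing) (V := R_NormedModule)).
    auto_derive; exact I.
  - intros y _. unfold G.
    assert (HW : (1 + (cexp (0, y) + cexp (- (0, y))) / 2)%C = RtoC (1 + cos y)).
    { unfold cexp, cis, Copp; simpl. rewrite Ropp_0, exp_0, cos_neg, sin_neg.
      unfold RtoC, Cdiv, Cinv, Cplus, Cmult; simpl. f_equal; field. }
    rewrite HW, re_scal_r.
    assert (H1 : 0 <= 1 + cos y) by (generalize (COS_bound y); lra).
    assert (H2 : 0 <= Re (g (cexp (0, y)))).
    { apply Hp. rewrite Cmod_cexp; simpl. rewrite exp_0; lra. }
    unfold Cminus. rewrite re_plus, re_opp. nra. }
assert (Hup : RInt (fun y => Re (G (x0, y))) 0 (2 * PI) <= 2 * PI * (Re l / 2 + 4 * eps)).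
{ replace (2 * PI * (Re l / 2 + 4 * eps)) with (RInt (fun _ => Re l / 2 + 4 * eps) 0 (2 * PI)).
  2:{ rewrite RInt_const. unfold scal; simpl. unfold mult; simpl. ring. }
  apply RInt_le; [lra|apply HQ; lra|apply (ex_RInt_const (V := R_NormedModule))|].
  intros y _.
  assert (Hb : Cmod (G (x0, y) - l / 2)%C <= 4 * eps).
  { unfold G.
    set (z := cexp (x0, y)). set (zi := cexp (- (x0, y))%C).
    assert (Hz : Cmod z = rho) by (unfold z; rewrite Cmod_cexp; exact Hx0).
    assert (Hzi : (z * zi = 1)%C) by apply cexp_opp.
    assert (Hzi' : Cmod zi * rho = 1).
    { rewrite <- Hz, <- Cmod_mult, Cmult_comm, Hzi. apply Cmod_1. }
    assert (Hc : (g z - g 0 - (z - 0) * l)%C = (g z - g 0 - z * l)%C) by ring.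
    specialize (Hd1 z). rewrite Hc in Hd1. replace (z - 0)%C with z in Hd1 by ring.
    rewrite Hz in Hd1. specialize (Hd1 Hrd).
    set (eta := (g z - g 0 - z * l)%C) in *.
    (* With [g z - g 0 = z l + eta], the product [z zi = 1] yields the main term [l / 2]. The other
       terms are at most [3/2 eps], [3/2 eps] and [eps / 2]. *)
    replace ((g z - g 0) * (1 + (z + zi) / 2) - l / 2)%C
      with (z * l * (1 + z / 2) + eta * (1 + z / 2) + eta * zi / 2 + (z * zi - 1) * l / 2)%C.
    2:{ unfold eta. field. }
    rewrite Hzi. replace ((1 - 1) * l / 2)%C with (RtoC 0) by field.
    rewrite Cplus_0_r.
    assert (H2 : forall u, Cmod (u / 2)%C = Cmod u / 2).
    { intros u. rewrite Cmod_div by (intros E; apply (f_equal Re) in E; simpl in E; lra).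
      rewrite Cmod_R, Rabs_pos_eq; lra. }
    assert (Hw : Cmod (1 + z / 2)%C <= 3 / 2).
    { eapply Rle_trans; [apply Cmod_triangle|]. rewrite Cmod_1, H2, Hz. lra. }
    assert (T1 := Cmod_triangle (z * l * (1 + z / 2) + eta * (1 + z / 2))%C (eta * zi / 2)%C).
    assert (T2 := Cmod_triangle (z * l * (1 + z / 2))%C (eta * (1 + z / 2))%C).
    rewrite H2, !Cmod_mult in *. rewrite Hz in *.
    assert (P1 := Cmod_ge_0 (1 + z / 2)%C). assert (P2 := Cmod_ge_0 zi).
    assert (P3 := Cmod_ge_0 eta).
    assert (rho * Cmod l * Cmod (1 + z / 2)%C <= eps * (3 / 2))
      by (apply Rmult_le_compat; nra).
    assert (Cmod eta * Cmod (1 + z / 2)%C <= eps * (3 / 2))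
      by (apply Rmult_le_compat; nra).
    assert (Cmod eta * Cmod zi <= (eps * rho) * Cmod zi)
      by (apply Rmult_le_compat_r; assumption).
    replace (eps * rho * Cmod zi) with (eps * (Cmod zi * rho)) in * by ring.
    rewrite Hzi' in *. lra. }
  assert (Hr := re_le_Cmod (G (x0, y) - l / 2)%C).
  apply Rabs_le_between in Hr. unfold Cminus in Hr.
  rewrite re_plus, re_opp in Hr.
  replace (Re (l / 2)%C) with (Re l / 2) in Hr.
  - destruct Hr as [_ Hr]. unfold Cminus in Hb. lra.
  - unfold Cdiv. replace (/ 2)%C with (RtoC (/ 2)) by (rewrite RtoC_inv; [reflexivity|lra]).
    rewrite re_scal_r. reflexivity. }
assert (Hfin : 2 * PI * (Re (g 0) + Re l / 2 + 4 * eps) >= 0) by lra.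
assert (Re (g 0) + Re l / 2 + 4 * eps < 0) by (unfold eps; lra).
nra.
Qed.

(** Along the segment from [a] to [b] the gradient bound gives [h' <= (2 / k) h] for [h = Re g].
    Integrating this differential inequality gives the factor [exp (2 / k)]. *)
Lemma harnack_disc (g : C -> C) (rho : R) (a b : C) :
  rho < 1 -> Cmod a <= rho -> Cmod b <= rho ->
  (forall z, Cmod z < 1 -> exists m, C_der g z m) ->
  (forall z, Cmod z < 1 -> 0 <= Re (g z)) ->
  Re (g b) <= exp (4 / (1 - rho)) * Re (g a).
Proof.
intros Hrho Ha Hb Hd Hp.
(* Since [Cmod (b - a) <= 2 rho], a step of length [k Cmod (b - a)] from a point of modulus at most
   [rho] reaches modulus at most [rho + (1 - rho) rho < 1]. *)
set (k := (1 - rho) / 2).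
assert (Hk : 0 < k) by (unfold k; lra).
assert (Hrho0 : 0 <= rho) by (generalize (Cmod_ge_0 a); lra).
set (gam := fun t : R => (a + t * (b - a))%C).
assert (Hgam : forall t, 0 <= t <= 1 -> Cmod (gam t) <= rho).
{ intros t Ht. unfold gam.
  replace (a + t * (b - a))%C with (RtoC (1 - t) * a + t * b)%C
    by (rewrite RtoC_minus; ring).
  eapply Rle_trans; [apply Cmod_triangle|]. rewrite !Cmod_mult, !Cmod_R.
  rewrite !Rabs_pos_eq by lra. nra. }
assert (Hba : Cmod (b - a)%C <= 2 * rho).
{ unfold Cminus. eapply Rle_trans; [apply Cmod_triangle|]. rewrite Cmod_opp. lra. }
assert (Hgrad : forall t l, 0 <= t <= 1 -> C_der g (gam t) l ->
   Re ((b - a) * l)%C <= 2 / k * Re (g (gam t))).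
{ intros t l Ht Hl.
  (* The gradient bound is a lower bound for the derivative; the opposite direction turns it into an
     upper one. *)
  set (e := (RtoC (- k) * (b - a))%C).
  assert (Hin : forall z, Cmod z <= 1 -> Cmod (gam t + z * e)%C < 1).
  { intros z Hz. eapply Rle_lt_trans; [apply Cmod_triangle|].
    unfold e. rewrite !Cmod_mult, Cmod_R, Rabs_Ropp, (Rabs_pos_eq k) by lra.
    specialize (Hgam t Ht). assert (P := Cmod_ge_0 z). assert (P' := Cmod_ge_0 (b - a)%C).
    assert (Cmod z * (k * Cmod (b - a)%C) <= 1 * (k * (2 * rho))).
    { apply Rmult_le_compat; [lra|nra|lra|nra]. }
    unfold k in *. nra. }
  assert (Haff : forall z, C_der (fun w => (gam t + w * e)%C) z (0 + (1 * e + z * 0))%C).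
  { intros z. apply C_der_plus; [apply C_der_const|].
    apply (C_der_mult (fun w => w) (fun _ => e)); [apply C_der_id|apply C_der_const]. }
  assert (H := positive_real_part_derivative (fun z => g (gam t + z * e)%C) (e * l)%C).
  cbv beta in H. replace (gam t + 0 * e)%C with (gam t) in H by ring.
  assert (H' : 0 <= Re (g (gam t)) + Re (e * l)%C / 2).
  { apply H.
    - intros z Hz. destruct (Hd _ (Hin z Hz)) as [m Hm]. eexists.
      apply (C_der_comp g (fun w => (gam t + w * e)%C)); [exact Hm|apply Haff].
    - intros z Hz. apply Hp, Hin, Hz.
    - replace (e * l)%C with ((0 + (1 * e + 0 * 0)) * l)%C by ring.
      apply (C_der_comp g (fun w => (gam t + w * e)%C)); [|apply Haff].
      replace (gam t + 0 * e)%C with (gam t) by ring. exact Hl. }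
  unfold e in H'.
  replace (RtoC (- k) * (b - a) * l)%C with (RtoC (- k) * ((b - a) * l))%C in H' by ring.
  rewrite re_scal_l in H'.
  apply (Rmult_le_reg_l (k / 2)); [lra|].
  replace (k / 2 * (2 / k * Re (g (gam t)))) with (Re (g (gam t))) by (field; lra). lra. }
assert (Hder : forall t l, C_der g (gam t) l ->
   is_derive (fun s => Re (g (gam s))) t (Re ((b - a) * l)%C)).
{ intros t l Hl.
  apply is_derive_Reals. intros eps He.
  (* The added 1 keeps [M] positive when [a = b]. *)
  set (M := Cmod (b - a)%C + 1).
  assert (HM : 0 < M) by (unfold M; generalize (Cmod_ge_0 (b - a)%C); lra).
  destruct (proj1 (C_der_iff _ _ _) Hl (eps / (2 * M))) as [d [Hd0 Hd1]].
  { apply Rdiv_lt_0_compat; lra. }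
  assert (HdM : 0 < d / M) by (apply Rdiv_lt_0_compat; lra).
  exists (mkposreal _ HdM). intros h Hh0 Hh; simpl in Hh.
  assert (Hah : 0 < Rabs h) by (apply Rabs_pos_lt; exact Hh0).
  specialize (Hd1 (gam (t + h))).
  replace (gam (t + h)%R - gam t)%C with (h * (b - a))%C in Hd1
    by (unfold gam; rewrite RtoC_plus; ring).
  rewrite Cmod_mult, Cmod_R in Hd1.
  assert (Hlt : Rabs h * Cmod (b - a)%C < d).
  { apply (Rmult_lt_compat_r M) in Hh; [|exact HM].
    replace (d / M * M) with d in Hh by (field; lra). unfold M in Hh. lra. }
  specialize (Hd1 Hlt).
  assert (Hre := Rle_trans _ _ _ (re_le_Cmod _) Hd1).
  replace (h * (b - a) * l)%C with (h * ((b - a) * l))%C in Hre by ring.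
  unfold Cminus in Hre. rewrite !re_plus, !re_opp, re_scal_l in Hre.
  replace ((Re (g (gam (t + h))) - Re (g (gam t))) / h - Re ((b - a) * l)%C)
    with ((Re (g (gam (t + h))) + - Re (g (gam t)) + - (h * Re ((b - a) * l)%C)) / h)
    by (field; exact Hh0).
  rewrite Rabs_div by exact Hh0.
  apply (Rmult_lt_reg_r (Rabs h)); [exact Hah|].
  unfold Rdiv at 1. rewrite Rmult_assoc, Rinv_l, Rmult_1_r by lra.
  eapply Rle_lt_trans; [exact Hre|].
  apply Rle_lt_trans with (eps / (2 * M) * (Rabs h * M)).
  - apply Rmult_le_compat_l; [left; apply Rdiv_lt_0_compat; lra|].
    fold (Cminus b a); apply Rmult_le_compat_l; unfold M; lra.
  - replace (eps / (2 * M) * (Rabs h * M)) with (eps * Rabs h / 2) by (field; lra). nra. }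
assert (Hd' : forall t, 0 <= t <= 1 -> exists l, C_der g (gam t) l).
{ intros t Ht. apply Hd. specialize (Hgam t Ht). lra. }
set (D := fun t => epsilon (inhabits (RtoC 0)) (fun l => C_der g (gam t) l)).
assert (HD : forall t, 0 <= t <= 1 -> C_der g (gam t) (D t)).
{ intros t Ht. apply epsilon_spec, Hd', Ht. }
(* The integrating factor makes [phi] nonincreasing on [[0, 1]]. *)
set (phi := fun t => exp (- (2 / k) * t) * Re (g (gam t))).
assert (Hphi : forall t, 0 <= t <= 1 -> derivable_pt_lim phi t
   (exp (- (2 / k) * t) * (Re ((b - a) * D t)%C - 2 / k * Re (g (gam t))))).
{ intros t Ht. apply is_derive_Reals. unfold phi.
  assert (He : is_derive (fun s => exp (- (2 / k) * s)) t (- (2 / k) * exp (- (2 / k) * t))).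
  { auto_derive; [exact I|ring]. }
  evar_last.
  - apply (is_derive_mult (K := R_AbsRing) _ _ _ _ _ He (Hder t _ (HD t Ht))). apply Rmult_comm.
  - unfold plus, mult; simpl. ring. }
destruct (MVT_cor2 _ _ 0 1 Rlt_0_1 Hphi) as [c [Hc [Hc0 Hc1]]].
assert (Hle : phi 1 <= phi 0).
{ assert (H := Hgrad c (D c) ltac:(lra) (HD c ltac:(lra))).
  assert (E : 0 <= exp (- (2 / k) * c) * (2 / k * Re (g (gam c)) - Re ((b - a) * D c)%C))
    by (apply Rmult_le_pos; [left; apply exp_pos|lra]).
  lra. }
unfold phi in Hle.
replace (gam 1) with b in Hle by (unfold gam; ring).
replace (gam 0) with a in Hle by (unfold gam; ring).
rewrite Rmult_0_r, exp_0, Rmult_1_l, Rmult_1_r, exp_Ropp in Hle.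
replace (4 / (1 - rho)) with (2 / k) by (unfold k; field; lra).
apply (Rmult_le_compat_l (exp (2 / k))) in Hle; [|left; apply exp_pos].
rewrite <- Rmult_assoc, Rinv_r, Rmult_1_l in Hle; [exact Hle|apply Rgt_not_eq, exp_pos].
Qed.

(** * Limits and the boundary of the symmetrized bidisc *)

(** Half-angle formulas: [p^2 - q^2 = x] and [2 p q = |y|], so the sign of [y] decides between
    [(p, q)] and [(p, - q)]. *)
Lemma Csqrt_exists (z : C) : exists w : C, (w * w)%C = z.
Proof.
destruct z as [x y].
set (r := sqrt (x ^ 2 + y ^ 2)).
assert (Hr0 : 0 <= r) by apply sqrt_pos.
assert (Hr : r * r = x ^ 2 + y ^ 2) by (apply sqrt_sqrt; nra).
assert (H1 : 0 <= (r + x) / 2) by nra.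
assert (H2 : 0 <= (r - x) / 2) by nra.
set (p := sqrt ((r + x) / 2)). set (q := sqrt ((r - x) / 2)).
assert (Hp : p * p = (r + x) / 2) by (apply sqrt_sqrt; exact H1).
assert (Hq : q * q = (r - x) / 2) by (apply sqrt_sqrt; exact H2).
assert (Hp0 : 0 <= p) by apply sqrt_pos.
assert (Hq0 : 0 <= q) by apply sqrt_pos.
assert (Hpq : (2 * (p * q)) * (2 * (p * q)) = y * y).
{ replace (2 * (p * q) * (2 * (p * q))) with (4 * (p * p) * (q * q)) by ring.
  rewrite Hp, Hq. nra. }
assert (Hpq0 : 0 <= p * q) by (apply Rmult_le_pos; assumption).
destruct (Rle_dec 0 y) as [Hy|Hy].
- exists (p, q). unfold Cmult; simpl. f_equal; [lra|nra].
- exists (p, - q). unfold Cmult; simpl. f_equal; [lra|nra].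
Qed.

(** [a] and [b] are the roots of [X^2 - s X + p], found by the quadratic formula. *)
Lemma pi2_surjective (w : C * C) : exists a b : C, w = pi2 (a, b).
Proof.
destruct w as [s p].
destruct (Csqrt_exists (s * s - 4 * p)%C) as [d Hd].
assert (H2 : (RtoC 2 <> 0)%C) by (intros E; apply (f_equal Re) in E; simpl in E; lra).
exists ((s + d) / 2)%C, ((s - d) / 2)%C. unfold pi2; simpl. f_equal.
- field.
- replace ((s + d) / 2 * ((s - d) / 2))%C with ((s * s - d * d) / 4)%C.
  + rewrite Hd. field.
  + field.
Qed.

Lemma pi2_sym (a b : C) : pi2 (a, b) = pi2 (b, a).
Proof. unfold pi2; simpl. f_equal; ring. Qed.

Lemma G2_pi2 (a b : C) : Cmod a < 1 -> Cmod b < 1 -> G2 (pi2 (a, b)).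
Proof. intros Ha Hb. exists a, b. auto. Qed.

(** A root outside the open disc keeps [(s, p)] away from [pi2 (c, d)], which makes [G2] open. At
    the root [w], [(w - c) (w - d)] equals the difference of the two polynomials, and dividing by
    [Cmod w >= 1] gives the bound. *)
Lemma root_perturbation (c d s p w : C) :
  Cmod c < 1 -> Cmod d < 1 -> (w * w - s * w + p = 0)%C -> 1 <= Cmod w ->
  (1 - Cmod c) * (1 - Cmod d) <= Cmod (s - (c + d))%C + Cmod (c * d - p)%C.
Proof.
intros Hc Hd Hw Hw1.
assert (E : ((w - c) * (w - d) = (s - (c + d)) * w + (c * d - p))%C).
{ replace ((w - c) * (w - d))%C with
    ((w * w - s * w + p) + ((s - (c + d)) * w + (c * d - p)))%C by ring.
  rewrite Hw. ring. }
apply (f_equal Cmod) in E. rewrite Cmod_mult in E.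
assert (T := Cmod_triangle ((s - (c + d)) * w)%C (c * d - p)%C).
rewrite Cmod_mult in T.
assert (T1 := Cmod_triangle_rev w c). assert (T2 := Cmod_triangle_rev w d).
assert (Pc := Cmod_ge_0 c). assert (Pd := Cmod_ge_0 d).
assert (P1 := Cmod_ge_0 (s - (c + d))%C). assert (P2 := Cmod_ge_0 (c * d - p)%C).
set (m := Cmod w) in *.
assert (M1 : m * (1 - Cmod c) <= Cmod (w - c)%C) by nra.
assert (M2 : 1 - Cmod d <= Cmod (w - d)%C) by nra.
assert (M3 : m * (1 - Cmod c) * (1 - Cmod d) <= Cmod (w - c)%C * Cmod (w - d)%C).
{ apply Rmult_le_compat; [nra|lra|assumption|assumption]. }
assert (M4 : Cmod (c * d - p)%C <= Cmod (c * d - p)%C * m) by nra.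
apply (Rmult_le_reg_l m); [lra|]. nra.
Qed.

Lemma Cmod_le_sum (z : C) : Cmod z <= Rabs (fst z) + Rabs (snd z).
Proof.
replace z with (RtoC (fst z) + Ci * RtoC (snd z))%C at 1.
- eapply Rle_trans; [apply Cmod_triangle|]. rewrite Cmod_mult, Cmod_Ci, !Cmod_R. lra.
- destruct z; unfold RtoC, Ci, Cmult, Cplus; simpl. f_equal; ring.
Qed.

(** Balls bound the four real coordinates separately, whence the factor 2 for the modulus. *)
Lemma ball_C2 (w v : C * C) (e : R) :
  ball w e v -> Cmod (fst v - fst w)%C < 2 * e /\ Cmod (snd v - snd w)%C < 2 * e.
Proof.
intros [[H1 H2] [H3 H4]].
change (Rabs (fst (fst v) - fst (fst w)) < e) in H1.
change (Rabs (snd (fst v) - snd (fst w)) < e) in H2.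
change (Rabs (fst (snd v) - fst (snd w)) < e) in H3.
change (Rabs (snd (snd v) - snd (snd w)) < e) in H4.
split; (eapply Rle_lt_trans; [apply Cmod_le_sum|]; simpl; unfold Rminus in *; lra).
Qed.

Lemma C2_ball (w v : C * C) (e : R) :
  Cmod (fst v - fst w)%C < e -> Cmod (snd v - snd w)%C < e -> ball w e v.
Proof.
intros H1 H2.
assert (K1 := Rmax_Cmod (fst v - fst w)%C). assert (K2 := Rmax_Cmod (snd v - snd w)%C).
assert (L1 := Rmax_l (Rabs (fst (fst v - fst w)%C)) (Rabs (snd (fst v - fst w)%C))).
assert (L2 := Rmax_r (Rabs (fst (fst v - fst w)%C)) (Rabs (snd (fst v - fst w)%C))).
assert (L3 := Rmax_l (Rabs (fst (snd v - snd w)%C)) (Rabs (snd (snd v - snd w)%C))).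
assert (L4 := Rmax_r (Rabs (fst (snd v - snd w)%C)) (Rabs (snd (snd v - snd w)%C))).
split; split;
  [change (Rabs (fst (fst v - fst w)%C) < e) | change (Rabs (snd (fst v - fst w)%C) < e)
  |change (Rabs (fst (snd v - snd w)%C) < e) | change (Rabs (snd (snd v - snd w)%C) < e)]; lra.
Qed.

Lemma G2_not_boundary (w : C * C) : G2 w -> ~ boundary G2 w.
Proof.
intros [c [d [Hc [Hd ->]]]] Hb. unfold unit_disc in Hc, Hd.
(* Each of the two coordinates moves by less than [2 e], so their sum stays below the bound of
   [root_perturbation]. *)
set (e := (1 - Cmod c) * (1 - Cmod d) / 4).
assert (He : 0 < e) by (unfold e; nra).
destruct (Hb (ball (pi2 (c, d)) e)) as [_ [v [Hv Hn]]].
{ exists (mkposreal e He). intros v Hv; exact Hv. }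
apply Hn. destruct (ball_C2 _ _ _ Hv) as [H1 H2].
destruct (pi2_surjective v) as [a [b ->]]. simpl in H1, H2.
rewrite (Cmod_minus_sym (a * b)%C) in H2.
assert (Root : forall x y, (x + y = a + b)%C -> (x * y = a * b)%C -> Cmod x < 1).
{ intros x y E1 E2. destruct (Rlt_dec (Cmod x) 1) as [|Hx]; [assumption|exfalso].
  assert (K := root_perturbation c d (a + b)%C (a * b)%C x Hc Hd).
  assert (Hroot : (x * x - (a + b) * x + a * b = 0)%C) by (rewrite <- E1, <- E2; ring).
  specialize (K Hroot ltac:(lra)). unfold e in *. lra. }
apply G2_pi2; [apply (Root a b)|apply (Root b a)]; ring.
Qed.

(** * Convergence of sequences in one and two complex variables *)

Definition C_lim (u : nat -> C) (l : C) : Prop := is_lim_seq (fun k => Cmod (u k - l)%C) 0.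

Definition C2_lim (u : nat -> C * C) (l : C * C) : Prop :=
  C_lim (fun k => fst (u k)) (fst l) /\ C_lim (fun k => snd (u k)) (snd l).

Lemma C_lim_iff (u : nat -> C) (l : C) :
  C_lim u l <-> forall e, 0 < e -> exists N, forall k, (N <= k)%nat -> Cmod (u k - l)%C < e.
Proof.
unfold C_lim. split.
- intros H e He. apply is_lim_seq_spec in H.
  destruct (H (mkposreal e He)) as [N HN]. exists N. intros k Hk. specialize (HN k Hk).
  simpl in HN. rewrite Rminus_0_r, Rabs_pos_eq in HN by apply Cmod_ge_0. exact HN.
- intros H. apply is_lim_seq_spec. intros [e He]. destruct (H e He) as [N HN].
  exists N. intros k Hk. simpl. rewrite Rminus_0_r, Rabs_pos_eq by apply Cmod_ge_0. auto.
Qed.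

Lemma C2_lim_filterlim (u : nat -> C * C) (l : C * C) :
  C2_lim u l <-> filterlim u eventually (locally l).
Proof.
split.
- intros [H1 H2] V [e He].
  destruct (proj1 (C_lim_iff _ _) H1 e (cond_pos e)) as [N1 HN1].
  destruct (proj1 (C_lim_iff _ _) H2 e (cond_pos e)) as [N2 HN2].
  exists (N1 + N2)%nat. intros k Hk. apply He, C2_ball; [apply HN1|apply HN2]; lia.
- intros H.
  assert (K : forall e, 0 < e -> exists N, forall k, (N <= k)%nat ->
    Cmod (fst (u k) - fst l)%C < e /\ Cmod (snd (u k) - snd l)%C < e).
  { intros e He. assert (He2 : 0 < e / 2) by lra.
    destruct (H (ball l (e / 2))) as [N HN].
    { exists (mkposreal _ He2). intros v Hv; exact Hv. }
    exists N. intros k Hk. destruct (ball_C2 _ _ _ (HN k Hk)) as [K1 K2]. lra. }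
  split; apply C_lim_iff; intros e He; destruct (K e He) as [N HN];
    exists N; intros k Hk; apply (HN k Hk).
Qed.

Lemma C_lim_squeeze (u : nat -> C) (l : C) (v : nat -> R) :
  is_lim_seq v 0 -> (forall k, Cmod (u k - l)%C <= v k) -> C_lim u l.
Proof.
intros Hv H. unfold C_lim.
apply is_lim_seq_le_le with (fun _ => 0) v; [|apply is_lim_seq_const|exact Hv].
intros k; split; [apply Cmod_ge_0|apply H].
Qed.

Lemma C_lim_const (l : C) : C_lim (fun _ => l) l.
Proof.
apply C_lim_iff. intros e He. exists 0%nat. intros k _.
replace (l - l)%C with (RtoC 0) by ring. rewrite Cmod_0. exact He.
Qed.

Lemma C_lim_minus (u v : nat -> C) (l m : C) :
  C_lim u l -> C_lim v m -> C_lim (fun k => (u k - v k)%C) (l - m)%C.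
Proof.
intros Hu Hv.
apply C_lim_squeeze with (fun k => Cmod (u k - l)%C + Cmod (v k - m)%C).
- replace (Finite 0) with (Rbar_plus 0 0) by (simpl; f_equal; ring).
  apply is_lim_seq_plus'; assumption.
- intros k. replace (u k - v k - (l - m))%C with ((u k - l) + - (v k - m))%C by ring.
  eapply Rle_trans; [apply Cmod_triangle|]. rewrite Cmod_opp. lra.
Qed.

Lemma C_lim_plus (u v : nat -> C) (l m : C) :
  C_lim u l -> C_lim v m -> C_lim (fun k => (u k + v k)%C) (l + m)%C.
Proof.
intros Hu Hv.
apply C_lim_squeeze with (fun k => Cmod (u k - l)%C + Cmod (v k - m)%C).
- replace (Finite 0) with (Rbar_plus 0 0) by (simpl; f_equal; ring).
  apply is_lim_seq_plus'; assumption.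
- intros k. replace (u k + v k - (l + m))%C with ((u k - l) + (v k - m))%C by ring.
  apply Cmod_triangle.
Qed.

Lemma C_lim_mult (u v : nat -> C) (l m : C) :
  C_lim u l -> C_lim v m -> C_lim (fun k => (u k * v k)%C) (l * m)%C.
Proof.
intros Hu Hv.
apply C_lim_squeeze with (fun k => Cmod (u k - l)%C * Cmod (v k - m)%C
   + (Cmod l * Cmod (v k - m)%C + Cmod m * Cmod (u k - l)%C)).
- replace (Finite 0) with (Finite (0 * 0 + (Cmod l * 0 + Cmod m * 0))) by (f_equal; ring).
  apply is_lim_seq_plus'; [apply is_lim_seq_mult'; assumption|].
  apply is_lim_seq_plus'; (apply is_lim_seq_mult'; [apply is_lim_seq_const|assumption]).
- intros k. replace (u k * v k - l * m)%C
    with ((u k - l) * (v k - m) + (l * (v k - m) + m * (u k - l)))%C by ring.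
  eapply Rle_trans; [apply Cmod_triangle|]. rewrite <- !Cmod_mult.
  apply Rplus_le_compat_l, Cmod_triangle.
Qed.

Lemma C_lim_Cmod (u : nat -> C) (l : C) :
  C_lim u l -> is_lim_seq (fun k => Cmod (u k)) (Cmod l).
Proof.
intros H. apply is_lim_seq_spec. intros [e He].
destruct (proj1 (C_lim_iff _ _) H e He) as [N HN]. exists N. intros k Hk. simpl.
specialize (HN k Hk). assert (T1 := Cmod_triangle_rev (u k) l).
assert (T2 := Cmod_triangle_rev l (u k)). rewrite (Cmod_minus_sym l) in T2.
apply Rabs_lt_between. lra.
Qed.

Lemma C_lim_Re (u : nat -> C) (l : C) : C_lim u l -> is_lim_seq (fun k => Re (u k)) (Re l).
Proof.
intros H. apply is_lim_seq_spec. intros [e He].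
destruct (proj1 (C_lim_iff _ _) H e He) as [N HN]. exists N. intros k Hk. simpl.
specialize (HN k Hk). assert (T := re_le_Cmod (u k - l)%C).
unfold Cminus in *. rewrite re_plus, re_opp in T. unfold Rminus. lra.
Qed.

Lemma C_lim_div (u v : nat -> C) (l m : C) :
  (forall k, v k <> 0%C) -> m <> 0%C ->
  C_lim u l -> C_lim v m -> C_lim (fun k => (u k / v k)%C) (l / m)%C.
Proof.
intros Hv0 Hm Hu Hv. apply C_lim_mult; [exact Hu|].
assert (Pm : 0 < Cmod m) by (apply Cmod_gt_0; exact Hm).
apply C_lim_squeeze with (fun k => Cmod (v k - m)%C / (Cmod (v k) * Cmod m)).
- replace (Finite 0) with (Finite (0 / (Cmod m * Cmod m))) by (f_equal; field; lra).
  apply is_lim_seq_div'; [exact Hv| |nra].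
  apply is_lim_seq_mult'; [apply C_lim_Cmod, Hv|apply is_lim_seq_const].
- intros k. specialize (Hv0 k).
  replace (/ v k - / m)%C with ((m - v k) / (v k * m))%C by (field; split; assumption).
  rewrite Cmod_div by (apply Cmult_neq_0; assumption).
  rewrite Cmod_mult, Cmod_minus_sym. lra.
Qed.

Lemma C_lim_subseq (u : nat -> C) (l : C) (phi : nat -> nat) :
  filterlim phi eventually eventually -> C_lim u l -> C_lim (fun k => u (phi k)) l.
Proof. intros Hphi Hu. exact (is_lim_seq_subseq _ _ phi Hphi Hu). Qed.

Lemma C_lim_unique (u : nat -> C) (l m : C) : C_lim u l -> C_lim u m -> l = m.
Proof.
intros Hl Hm. assert (H := C_lim_minus _ _ _ _ Hl Hm).
apply C_lim_Cmod in H.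
assert (E : Cmod (l - m)%C = 0).
{ apply is_lim_seq_unique in H.
  rewrite (Lim_seq_ext _ (fun _ => 0)), Lim_seq_const in H.
  - injection H; auto.
  - intros k. replace (u k - u k)%C with (RtoC 0) by ring. apply Cmod_0. }
apply Cmod_eq_0 in E. replace l with ((l - m) + m)%C by ring. rewrite E. ring.
Qed.

(** * Subsequences and compactness of the closure of the symmetrized bidisc *)

Lemma bounded_subsequence (u : nat -> R) (M : R) :
  (forall n, Rabs (u n) <= M) ->
  exists phi : nat -> nat, filterlim phi eventually eventually /\
    exists l : R, is_lim_seq (fun k => u (phi k)) l.
Proof.
intros HM.
destruct (Bolzano_Weierstrass u (fun c => - M <= c <= M)) as [l Hl].
{ apply compact_P3. }
{ intros n. apply Rabs_le_between, HM. }
destruct (dependent_choice nat (fun n k => True)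
   (fun n k k' => (k < k')%nat /\ Rabs (u k' - l) < / (INR n + 1)) 0%nat I) as [phi [_ Hphi]].
{ intros n k _.
  assert (Hn : 0 < / (INR n + 1)) by (apply Rinv_0_lt_compat; generalize (pos_INR n); lra).
  destruct (Hl (disc l (mkposreal _ Hn)) (S k)) as [k' [Hk' Hd]].
  { exists (mkposreal _ Hn). intros x Hx; exact Hx. }
  exists k'. split; [exact I|]. split; [lia|exact Hd]. }
(* Shifted by one, because the starting index [phi 0] satisfies no estimate. *)
exists (fun k => phi (S k)). split.
- apply eventually_subseq. intros n. apply (Hphi (S n)).
- exists l. apply is_lim_seq_spec. intros e.
  destruct (archimed_cor1 e (cond_pos e)) as [N [HN HN0]].
  exists N. intros n Hn. destruct (proj2 (Hphi n)) as [_ H].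
  eapply Rlt_trans; [exact H|]. eapply Rle_lt_trans; [|exact HN].
  apply Rinv_le_contravar; [apply lt_0_INR; exact HN0|].
  apply le_INR in Hn. lra.
Qed.

Lemma bounded_C_subsequence (u : nat -> C) (M : R) :
  (forall n, Cmod (u n) <= M) ->
  exists phi : nat -> nat, filterlim phi eventually eventually /\
    exists l : C, C_lim (fun k => u (phi k)) l /\ Cmod l <= M.
Proof.
intros HM.
destruct (bounded_subsequence (fun n => fst (u n)) M) as [f1 [F1 [x Hx]]].
{ intros n. eapply Rle_trans; [apply (re_le_Cmod (u n))|apply HM]. }
destruct (bounded_subsequence (fun n => snd (u (f1 n))) M) as [f2 [F2 [y Hy]]].
{ intros n. eapply Rle_trans; [|apply (HM (f1 n))].
  eapply Rle_trans; [apply Rmax_r|apply Rmax_Cmod]. }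
exists (fun k => f1 (f2 k)). split; [apply (filterlim_comp _ _ _ f2 f1 _ _ _ F2 F1)|].
assert (HL : C_lim (fun k => u (f1 (f2 k))) (x, y)).
{ assert (Hx' := is_lim_seq_subseq _ _ f2 F2 Hx).
  apply C_lim_squeeze with
    (fun k => Rabs (fst (u (f1 (f2 k))) - x) + Rabs (snd (u (f1 (f2 k))) - y)).
  - replace (Finite 0) with (Finite (Rabs (x - x) + Rabs (y - y))).
    2:{ rewrite !Rminus_diag, Rabs_R0. f_equal; ring. }
    apply is_lim_seq_plus'.
    + apply (is_lim_seq_abs _ (x - x)).
      apply is_lim_seq_minus'; [exact Hx'|apply is_lim_seq_const].
    + apply (is_lim_seq_abs _ (y - y)).
      apply is_lim_seq_minus'; [exact Hy|apply is_lim_seq_const].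
  - intros k. apply Cmod_le_sum. }
exists (x, y). split; [exact HL|].
apply (is_lim_seq_le _ (fun _ => M) _ _ (fun n => HM _) (C_lim_Cmod _ _ HL) (is_lim_seq_const M)).
Qed.

(** Preimages under [pi2] are chosen in the closed bidisc, which is compact, and sums and products
    pass to the limit. *)
Lemma G2_subsequence (u : nat -> C * C) :
  (forall n, G2 (u n)) ->
  exists phi : nat -> nat, filterlim phi eventually eventually /\
    exists a b : C, Cmod a <= 1 /\ Cmod b <= 1 /\ C2_lim (fun k => u (phi k)) (pi2 (a, b)).
Proof.
intros Hu.
assert (Hab : forall n, exists ab : C * C, Cmod (fst ab) <= 1 /\ Cmod (snd ab) <= 1 /\ u n = pi2 ab).
{ intros n. destruct (Hu n) as [a [b [Ha [Hb E]]]]. unfold unit_disc in *.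
  exists (a, b); simpl. repeat split; [lra|lra|exact E]. }
set (ab := fun n => epsilon (inhabits ((RtoC 0, RtoC 0) : C * C))
  (fun ab : C * C => Cmod (fst ab) <= 1 /\ Cmod (snd ab) <= 1 /\ u n = pi2 ab)).
assert (HAB : forall n, Cmod (fst (ab n)) <= 1 /\ Cmod (snd (ab n)) <= 1 /\ u n = pi2 (ab n)).
{ intros n. apply epsilon_spec, Hab. }
clearbody ab.
destruct (bounded_C_subsequence (fun n => fst (ab n)) 1) as [f1 [F1 [a [Ha Ha1]]]].
{ intros n. apply HAB. }
destruct (bounded_C_subsequence (fun n => snd (ab (f1 n))) 1) as [f2 [F2 [b [Hb Hb1]]]].
{ intros n. apply HAB. }
exists (fun k => f1 (f2 k)). split; [apply (filterlim_comp _ _ _ f2 f1 _ _ _ F2 F1)|].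
exists a, b. split; [exact Ha1|split; [exact Hb1|]].
apply (C_lim_subseq _ _ f2 F2) in Ha.
split; simpl.
- assert (H := C_lim_plus _ _ _ _ Ha Hb).
  eapply is_lim_seq_ext; [|exact H]. intros k. simpl.
  rewrite (proj2 (proj2 (HAB (f1 (f2 k))))). reflexivity.
- assert (H := C_lim_mult _ _ _ _ Ha Hb).
  eapply is_lim_seq_ext; [|exact H]. intros k. simpl.
  rewrite (proj2 (proj2 (HAB (f1 (f2 k))))). reflexivity.
Qed.

(** * Comparison of orbits *)

(* [C_module] and [C_NormedModule] have the same norm but different uniform
   structures; derivatives of functions of one variable use the former as domain. *)
Local Notation C_module := (AbsRing_NormedModule C_AbsRing).
Local Notation C2_module := (prod_NormedModule C_AbsRing C_NormedModule C_NormedModule).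

Lemma ex_filterdiff_slice (b z : C) :
  ex_filterdiff (K := C_AbsRing) (U := C_module)
    (V := C2_module)
    (fun t : C => pi2 (t, b)) (locally (T := AbsRing_UniformSpace C_AbsRing) z).
Proof.
assert (Hid : is_linear (K := C_AbsRing) (U := C_module)
                (V := C_NormedModule) (fun t : C => t)).
{ split; [reflexivity|reflexivity|]. exists 1. split; [lra|].
  intros x. rewrite Rmult_1_l. right. reflexivity. }
assert (Hb : is_linear (K := C_AbsRing) (U := C_module)
                (V := C_NormedModule) (fun t : C => (t * b)%C)).
{ split.
  - intros x y. change ((x + y) * b = x * b + y * b)%C. ring.
  - intros k x. change ((k * x) * b = k * (x * b))%C. ring.
  - exists (Cmod b + 1). split; [generalize (Cmod_ge_0 b); lra|].
    intros x. change (Cmod (x * b)%C <= (Cmod b + 1) * Cmod x). rewrite Cmod_mult.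
    generalize (Cmod_ge_0 x) (Cmod_ge_0 b). nra. }
eexists.
(* The slice is the linear map [t |-> (t, t b)] plus the constant [(b, 0)]. *)
apply (filterdiff_ext
  (fun t : C_module =>
     plus (G := C2_module)
       (t, (t * b)%C) (b, RtoC 0))).
- intros t. apply injective_projections; [reflexivity|exact (Cplus_0_r (Cmult t b))].
- apply filterdiff_plus_fct.
  + apply filterdiff_linear. exact (is_linear_prod _ _ Hid Hb).
  + apply filterdiff_const.
Qed.

Section Iterates.

Variable f : C * C -> C * C.
Hypothesis Hmap : forall z, G2 z -> G2 (f z).
Hypothesis Hhol : holomorphic_on G2 f.

Lemma iter_G2 (n : nat) (z : C * C) : G2 z -> G2 (Nat.iter n f z).
Proof. intros Hz. induction n as [|n IH]; simpl; [exact Hz|apply Hmap, IH]. Qed.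

Lemma ex_filterdiff_iter_slice (n : nat) (b z : C) :
  Cmod b < 1 -> Cmod z < 1 ->
  ex_filterdiff (K := C_AbsRing) (U := C_module)
    (V := C2_module)
    (fun t : C => Nat.iter n f (pi2 (t, b))) (locally (T := AbsRing_UniformSpace C_AbsRing) z).
Proof.
intros Hb Hz. induction n as [|n [l IH]]; simpl.
- apply ex_filterdiff_slice.
- destruct (Hhol (Nat.iter n f (pi2 (z, b)))) as [m Hm].
  { apply iter_G2, G2_pi2; assumption. }
  eexists. exact (filterdiff_comp' (U := C_module) (V := C2_module) (W := C2_module) _ f z _ _ IH Hm).
Qed.

(** A complex linear map of the plane is multiplication by its value at 1. *)
Lemma filterdiff_C_der (g : C -> C) (z : C) (l : C -> C) :
  filterdiff (K := C_AbsRing) (U := C_module) (V := C_NormedModule)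
    g (locally (T := AbsRing_UniformSpace C_AbsRing) z) l -> C_der g z (l 1%C).
Proof.
intros [Hl H]. split; [apply is_linear_scal_l|].
intros x Hx eps. specialize (H x Hx eps).
revert H. apply filter_imp. intros y Hy.
assert (E : forall t : C, l t = (t * l 1)%C).
{ intros t. replace t with (t * 1)%C at 1 by ring.
  apply (linear_scal (K := C_AbsRing) (U := C_module)
          (V := C_NormedModule) l Hl t (RtoC 1)). }
rewrite E in Hy. exact Hy.
Qed.

Lemma iter_slice_C_der (n : nat) (b z : C) :
  Cmod b < 1 -> Cmod z < 1 ->
  (exists l, C_der (fun t => fst (Nat.iter n f (pi2 (t, b)))) z l) /\
  (exists l, C_der (fun t => snd (Nat.iter n f (pi2 (t, b)))) z l).
Proof.
intros Hb Hz. destruct (ex_filterdiff_iter_slice n b z Hb Hz) as [l Hl].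
split; eexists; apply filterdiff_C_der.
- apply (filterdiff_comp' (U := C_module) (V := C2_module) (W := C_NormedModule)
    _ (fun w => fst w) z _ (fun w => fst w) Hl).
  apply filterdiff_linear, is_linear_fst.
- apply (filterdiff_comp' (U := C_module) (V := C2_module) (W := C_NormedModule)
    _ (fun w => snd w) z _ (fun w => snd w) Hl).
  apply filterdiff_linear, is_linear_snd.
Qed.

(* Holomorphy of [P] on [G2] is expressed along holomorphic curves. *)
Definition half_plane_test (P : C * C -> C) : Prop :=
  (forall w, G2 w -> 0 <= Re (P w)) /\
  (forall s p z ds dp, G2 (s z, p z) -> C_der s z ds -> C_der p z dp ->
     exists k, C_der (fun t => P (s t, p t)) z k).

(** Along the slice, [P] composed with the iterate is holomorphic with nonnegative real part for
    every [n], so the disc inequality applies with a constant depending on [rho] only. *)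
Lemma harnack_slice (n : nat) (P : C * C -> C) (rho : R) (a a' b : C) :
  half_plane_test P -> rho < 1 -> Cmod a <= rho -> Cmod a' <= rho -> Cmod b < 1 ->
  Re (P (Nat.iter n f (pi2 (a', b)))) <=
    exp (4 / (1 - rho)) * Re (P (Nat.iter n f (pi2 (a, b)))).
Proof.
intros [HP1 HP2] Hrho Ha Ha' Hb.
apply (harnack_disc (fun t => P (Nat.iter n f (pi2 (t, b)))) rho a a'); try assumption.
- intros z Hz. destruct (iter_slice_C_der n b z Hb Hz) as [[l1 H1] [l2 H2]].
  destruct (HP2 (fun t => fst (Nat.iter n f (pi2 (t, b))))
                (fun t => snd (Nat.iter n f (pi2 (t, b)))) z l1 l2) as [k Hk].
  + rewrite <- surjective_pairing. apply iter_G2, G2_pi2; assumption.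
  + exact H1.
  + exact H2.
  + exists k. eapply C_der_ext; [|exact Hk].
    intros t. cbv beta. rewrite <- surjective_pairing. reflexivity.
- intros z Hz. apply HP1, iter_G2, G2_pi2; assumption.
Qed.

(** One root is moved at a time, from [pi2 (a, b)] to [pi2 (a', b)] to [pi2 (a', b')]; the symmetry
    of [pi2] turns the second move into a slice as well. *)
Lemma harnack_G2 (z w : C * C) :
  G2 z -> G2 w ->
  exists K, forall n P, half_plane_test P ->
    Re (P (Nat.iter n f w)) <= K * Re (P (Nat.iter n f z)).
Proof.
intros [a [b [Ha [Hb ->]]]] [a' [b' [Ha' [Hb' ->]]]]. unfold unit_disc in *.
set (rho := Rmax (Rmax (Cmod a) (Cmod a')) (Rmax (Cmod b) (Cmod b'))).
assert (Hrho : rho < 1) by (repeat apply Rmax_lub_lt; assumption).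
assert (A1 : Cmod a <= rho) by (eapply Rle_trans; [apply Rmax_l|apply Rmax_l]).
assert (A2 : Cmod a' <= rho) by (eapply Rle_trans; [apply Rmax_r|apply Rmax_l]).
assert (A3 : Cmod b <= rho) by (eapply Rle_trans; [apply Rmax_l|apply Rmax_r]).
assert (A4 : Cmod b' <= rho) by (eapply Rle_trans; [apply Rmax_r|apply Rmax_r]).
exists (exp (4 / (1 - rho)) * exp (4 / (1 - rho))). intros n P HP.
assert (H1 := harnack_slice n P rho a a' b HP Hrho A1 A2 Hb).
assert (H2 := harnack_slice n P rho b b' a' HP Hrho A3 A4 Ha').
rewrite (pi2_sym b'), (pi2_sym b) in H2.
eapply Rle_trans; [exact H2|]. rewrite Rmult_assoc.
apply Rmult_le_compat_l; [left; apply exp_pos|exact H1].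
Qed.

End Iterates.

(** * Test functions with positive real part *)

Definition peak (lam : C) (w : C * C) : C := (1 - lam * fst w / 2)%C.

(** Half the harmonic mean of [1 - lam a] and [1 - lam b], written in the symmetric coordinates
    [a + b] and [a b]; see [hmean_pi2]. *)
Definition hmean (lam : C) (w : C * C) : C :=
  ((1 - lam * fst w + lam * lam * snd w) / (2 - lam * fst w))%C.

Lemma Re_le_Cmod (z : C) : Re z <= Cmod z.
Proof. eapply Rle_trans; [apply Rle_abs|apply re_le_Cmod]. Qed.

Lemma Re_1_eq (z : C) : Cmod z <= 1 -> 1 <= Re z -> z = 1%C.
Proof.
intros H1 H2. assert (H := Cmod2_alt z). assert (H0 := Cmod_ge_0 z).
assert (Im z = 0) by nra. assert (Re z = 1) by nra.
destruct z as [x y]; simpl in *. subst. reflexivity.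
Qed.

Lemma peak_pi2 (lam a b : C) :
  Re (peak lam (pi2 (a, b))) = 1 - (Re (lam * a)%C + Re (lam * b)%C) / 2.
Proof.
unfold peak, pi2; simpl fst.
replace (1 - lam * (a + b) / 2)%C with (1 + RtoC (- / 2) * (lam * a + lam * b))%C.
- rewrite re_plus, re_scal_l, re_plus, re_RtoC. field.
- rewrite RtoC_opp, RtoC_inv by lra. field.
Qed.

(** The real part is [(|x|^2 Re y + |y|^2 Re x) / |x + y|^2]. *)
Lemma harmonic_mean_Re (x y : C) :
  0 < Re x -> 0 < Re y -> (x + y <> 0)%C /\ 0 < Re (x * y / (x + y))%C.
Proof.
intros Hx Hy.
assert (H0 : (x + y <> 0)%C).
{ intros E. apply (f_equal Re) in E. rewrite re_plus in E. simpl in E. lra. }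
split; [exact H0|].
destruct x as [x1 x2], y as [y1 y2]; simpl in Hx, Hy.
unfold Cdiv, Cmult, Cplus, Cinv; simpl.
assert (HD : 0 < (x1 + y1) * ((x1 + y1) * 1) + (x2 + y2) * ((x2 + y2) * 1)).
{ assert (0 < (x1 + y1) * (x1 + y1)) by (apply Rmult_lt_0_compat; lra).
  generalize (Rle_0_sqr (x2 + y2)). unfold Rsqr. lra. }
set (Dn := (x1 + y1) * ((x1 + y1) * 1) + (x2 + y2) * ((x2 + y2) * 1)) in *.
match goal with |- 0 < ?A => replace A with
  (((x1 * x1 + x2 * x2) * y1 + (y1 * y1 + y2 * y2) * x1) / Dn) end.
- apply Rdiv_lt_0_compat; [|exact HD].
  assert (0 < (x1 * x1 + x2 * x2) * y1) by (apply Rmult_lt_0_compat; nra).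
  assert (0 < (y1 * y1 + y2 * y2) * x1) by (apply Rmult_lt_0_compat; nra). lra.
- unfold Dn. field. unfold Dn in HD. lra.
Qed.

Lemma Re_1_minus_pos (z : C) : Cmod z <= 1 -> z <> 1%C -> 0 < Re (1 - z)%C.
Proof.
intros H1 H2. unfold Cminus. rewrite re_plus, re_opp, re_RtoC.
destruct (Rlt_dec (Re z) 1) as [|Hn]; [lra|].
exfalso. apply H2, Re_1_eq; [exact H1|lra].
Qed.

Lemma hmean_pi2 (lam a b : C) :
  hmean lam (pi2 (a, b)) =
    ((1 - lam * a) * (1 - lam * b) / ((1 - lam * a) + (1 - lam * b)))%C.
Proof. unfold hmean, pi2; simpl fst; simpl snd. f_equal; ring. Qed.

Lemma hmean_pos (lam a b : C) :
  Cmod (lam * a)%C <= 1 -> Cmod (lam * b)%C <= 1 -> (lam * a <> 1)%C -> (lam * b <> 1)%C ->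
  (2 - lam * fst (pi2 (a, b)) <> 0)%C /\ 0 < Re (hmean lam (pi2 (a, b))).
Proof.
intros Ha Hb Ha1 Hb1.
destruct (harmonic_mean_Re _ _ (Re_1_minus_pos _ Ha Ha1) (Re_1_minus_pos _ Hb Hb1)) as [H0 H].
rewrite hmean_pi2. split; [|exact H].
intros E. apply H0. rewrite <- E. unfold pi2; simpl. ring.
Qed.

Lemma Cmod_mult_lt_1 (lam a : C) : Cmod lam = 1 -> Cmod a < 1 -> Cmod (lam * a)%C < 1.
Proof. intros H1 H2. rewrite Cmod_mult, H1. lra. Qed.

Lemma Cmod_lt_1_neq (z : C) : Cmod z < 1 -> z <> 1%C.
Proof. intros H E. rewrite E, Cmod_1 in H. lra. Qed.

Lemma hmean_G2 (lam : C) (w : C * C) :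
  Cmod lam = 1 -> G2 w -> (2 - lam * fst w <> 0)%C /\ 0 < Re (hmean lam w).
Proof.
intros Hl [a [b [Ha [Hb ->]]]]. unfold unit_disc in *.
assert (H1 := Cmod_mult_lt_1 lam a Hl Ha). assert (H2 := Cmod_mult_lt_1 lam b Hl Hb).
apply hmean_pos; try lra; apply Cmod_lt_1_neq; assumption.
Qed.

Lemma peak_G2 (lam : C) (w : C * C) : Cmod lam = 1 -> G2 w -> 0 < Re (peak lam w).
Proof.
intros Hl [a [b [Ha [Hb ->]]]]. unfold unit_disc in *. rewrite peak_pi2.
assert (H1 := Cmod_mult_lt_1 lam a Hl Ha). assert (H2 := Cmod_mult_lt_1 lam b Hl Hb).
assert (K1 := Re_le_Cmod (lam * a)%C). assert (K2 := Re_le_Cmod (lam * b)%C). lra.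
Qed.

Lemma peak_test (lam : C) : Cmod lam = 1 -> half_plane_test (peak lam).
Proof.
intros Hl. split.
- intros w Hw. left. apply peak_G2; assumption.
- intros s p z ds dp _ Hs _. eexists. unfold peak; simpl.
  apply C_der_minus; [apply C_der_const|].
  apply C_der_mult; [|apply C_der_const].
  apply C_der_mult; [apply C_der_const|exact Hs].
Qed.

Lemma hmean_test (lam : C) : Cmod lam = 1 -> half_plane_test (hmean lam).
Proof.
intros Hl. split.
- intros w Hw. left. apply hmean_G2; assumption.
- intros s p z ds dp Hz Hs Hp. unfold hmean; simpl.
  eapply C_der_div.
  + apply (hmean_G2 lam (s z, p z) Hl Hz).
  + apply C_der_plus.
    * apply C_der_minus; [apply C_der_const|].
      apply C_der_mult; [apply C_der_const|exact Hs].
    * apply C_der_mult; [apply C_der_const|exact Hp].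
  + apply C_der_minus; [apply C_der_const|].
    apply C_der_mult; [apply C_der_const|exact Hs].
Qed.

(** Only approach from inside [G2] counts, since [w] may lie on the boundary and the denominator of
    [hmean] is known to be nonzero in [G2]. *)
Definition G2_continuous_at (P : C * C -> C) (w : C * C) : Prop :=
  forall u, (forall k, G2 (u k)) -> C2_lim u w -> is_lim_seq (fun k => Re (P (u k))) (Re (P w)).

Lemma peak_continuous (lam : C) (w : C * C) : G2_continuous_at (peak lam) w.
Proof.
intros u _ [Hu _]. apply C_lim_Re. unfold peak.
apply C_lim_minus; [apply C_lim_const|].
apply C_lim_mult; [|apply C_lim_const].
apply C_lim_mult; [apply C_lim_const|exact Hu].
Qed.

Lemma hmean_continuous (lam : C) (w : C * C) :
  Cmod lam = 1 -> (2 - lam * fst w <> 0)%C -> G2_continuous_at (hmean lam) w.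
Proof.
intros Hl Hw u HG [Hu Hv]. apply C_lim_Re. unfold hmean.
apply C_lim_div; [|exact Hw| |].
- intros k. apply hmean_G2; [exact Hl|apply HG].
- apply C_lim_plus.
  + apply C_lim_minus; [apply C_lim_const|].
    apply C_lim_mult; [apply C_lim_const|exact Hu].
  + apply C_lim_mult; [apply C_lim_const|exact Hv].
- apply C_lim_minus; [apply C_lim_const|].
  apply C_lim_mult; [apply C_lim_const|exact Hu].
Qed.

Lemma Cconj_unimodular (c : C) : Cmod c = 1 -> (Cconj c * c = 1)%C.
Proof.
intros H. rewrite Cmult_comm, <- Cmod2_conj, H. simpl. unfold RtoC. f_equal. ring.
Qed.

(** The numerator contains [1 - lam b = 0], while the denominator reduces to [1 - lam a]. *)
Lemma hmean_vanishes (lam a b : C) :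
  (lam * b = 1)%C -> Cmod lam = 1 -> Cmod a <= 1 -> (lam * a <> 1)%C ->
  (2 - lam * fst (pi2 (a, b)) <> 0)%C /\ Re (hmean lam (pi2 (a, b))) = 0.
Proof.
intros Hb Hl Ha Ha1. split.
- intros E. apply Ha1.
  replace (lam * a)%C with (2 - lam * b - (2 - lam * fst (pi2 (a, b))))%C
    by (unfold pi2; simpl; ring).
  rewrite E, Hb. ring.
- rewrite hmean_pi2, Hb. unfold Cdiv.
  replace ((1 - lam * a) * (1 - 1) * / (1 - lam * a + (1 - 1)))%C with (RtoC 0) by ring.
  reflexivity.
Qed.

(** Take [lam] conjugate to [c]: [peak] serves if also [lam d = 1], and [hmean] otherwise. *)
Lemma boundary_test (c d : C) :
  Cmod c = 1 -> Cmod d <= 1 ->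
  exists P, half_plane_test P /\ (forall w, G2 w -> G2_continuous_at P w /\ 0 < Re (P w)) /\
    G2_continuous_at P (pi2 (c, d)) /\ Re (P (pi2 (c, d))) = 0.
Proof.
intros Hc Hd.
set (lam := Cconj c).
assert (Hl : Cmod lam = 1) by (unfold lam; rewrite Cmod_conj; exact Hc).
assert (Hlc : (lam * c = 1)%C) by (apply Cconj_unimodular; exact Hc).
destruct (classic (lam * d = 1)%C) as [E|E].
- exists (peak lam). split; [apply peak_test, Hl|]. split.
  + intros w Hw. split; [apply peak_continuous|apply peak_G2; assumption].
  + split; [apply peak_continuous|]. rewrite peak_pi2, Hlc, E, re_RtoC. lra.
- exists (hmean lam). split; [apply hmean_test, Hl|]. split.
  + intros w Hw. destruct (hmean_G2 lam w Hl Hw).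
    split; [apply hmean_continuous|]; assumption.
  + destruct (hmean_vanishes lam d c Hlc Hl Hd E) as [H1 H2].
    rewrite pi2_sym. split; [apply hmean_continuous; assumption|exact H2].
Qed.

(** Along a common subsequence both orbits converge, and Harnack's inequality passes to the limit as
    [Re (P xi) <= K Re (P eta)]. *)
Lemma target_transfer (f : C * C -> C * C) (z0 z xi : C * C) :
  (forall z, G2 z -> G2 (f z)) -> holomorphic_on G2 f ->
  G2 z0 -> G2 z -> target_at f z xi ->
  (exists c d, Cmod c <= 1 /\ Cmod d <= 1 /\ xi = pi2 (c, d)) /\
  exists eta, target_at f z0 eta /\
    forall P, half_plane_test P -> G2_continuous_at P eta -> G2_continuous_at P xi ->
      Re (P eta) = 0 -> Re (P xi) <= 0.
Proof.
intros Hmap Hhol Hz0 Hz [Hbd [n [Hn0 [Hn Hlim]]]].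
apply C2_lim_filterlim in Hlim.
destruct (G2_subsequence (fun k => Nat.iter (n k) f z0)) as [f1 [F1 [a [b [Ha [Hb Hab]]]]]].
{ intros k. apply iter_G2; assumption. }
destruct (G2_subsequence (fun k => Nat.iter (n (f1 k)) f z)) as [f2 [F2 [c [d [Hc [Hd Hcd]]]]]].
{ intros k. apply iter_G2; assumption. }
set (m := fun k => n (f1 (f2 k))).
assert (Fm : filterlim (fun k => f1 (f2 k)) eventually eventually)
  by apply (filterlim_comp _ _ _ f2 f1 _ _ _ F2 F1).
assert (Hm : filterlim m eventually eventually)
  by apply (filterlim_comp _ _ _ (fun k => f1 (f2 k)) n _ _ _ Fm Hn).
(* The orbit of [z] already tends to [xi]; the second extraction only exhibits [xi] as the image of
   a point of the closed bidisc. *)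
assert (Exi : xi = pi2 (c, d)).
{ destruct Hlim as [L1 L2]. destruct Hcd as [L3 L4].
  apply (C_lim_subseq _ _ _ Fm) in L1. apply (C_lim_subseq _ _ _ Fm) in L2.
  rewrite (surjective_pairing xi), (surjective_pairing (pi2 (c, d))).
  f_equal; [exact (C_lim_unique _ _ _ L1 L3)|exact (C_lim_unique _ _ _ L2 L4)]. }
rewrite <- Exi in Hcd.
assert (Hu : C2_lim (fun k => Nat.iter (m k) f z0) (pi2 (a, b))).
{ destruct Hab as [L1 L2]. split; [apply (C_lim_subseq _ _ _ F2 L1)|apply (C_lim_subseq _ _ _ F2 L2)]. }
destruct (harnack_G2 f Hmap Hhol z0 z Hz0 Hz) as [K HK].
assert (Hcomp : forall P, half_plane_test P -> G2_continuous_at P (pi2 (a, b)) ->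
  G2_continuous_at P xi -> Re (P (pi2 (a, b))) = 0 -> Re (P xi) <= 0).
{ intros P HP C1 C2 E.
  specialize (C1 _ (fun k => iter_G2 f Hmap (m k) z0 Hz0) Hu).
  specialize (C2 _ (fun k => iter_G2 f Hmap (m k) z Hz) Hcd).
  rewrite E in C1.
  assert (C3 := is_lim_seq_scal_l _ K _ C1). simpl in C3.
  rewrite Rmult_0_r in C3.
  apply (is_lim_seq_le _ _ _ _ (fun k => HK (m k) P HP) C2 C3). }
split; [exists c, d; auto|].
exists (pi2 (a, b)). split; [|exact Hcomp].
split.
(* With the roles of the orbits exchanged: a test function vanishing at [xi] would have real part at
   most 0 at a limit inside [G2], where it is positive. *)
- assert (HnG : ~ G2 (pi2 (a, b))).
  { intros HG.
    destruct (harnack_G2 f Hmap Hhol z z0 Hz Hz0) as [K' HK'].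
    assert (Hback : forall P, half_plane_test P -> (forall w, G2 w -> G2_continuous_at P w /\ 0 < Re (P w)) ->
      G2_continuous_at P xi -> Re (P xi) = 0 -> False).
    { intros P HP HPG C2 E. destruct (HPG _ HG) as [C1 Hpos].
      specialize (C1 _ (fun k => iter_G2 f Hmap (m k) z0 Hz0) Hu).
      specialize (C2 _ (fun k => iter_G2 f Hmap (m k) z Hz) Hcd).
      rewrite E in C2.
      assert (C3 := is_lim_seq_scal_l _ K' _ C2).
      simpl in C3. rewrite Rmult_0_r in C3.
      assert (L := is_lim_seq_le _ _ _ _ (fun k => HK' (m k) P HP) C1 C3). simpl in L. lra. }
    assert (Hone : forall x y, Cmod x = 1 -> Cmod y <= 1 -> xi = pi2 (x, y) -> False).
    { intros x y Hx Hy E. destruct (boundary_test x y Hx Hy) as [P [P1 [P2 [P3 P4]]]].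
      rewrite <- E in P3, P4. apply (Hback P); assumption. }
    destruct Hc as [Hc|Hc]; [|apply (Hone c d Hc Hd Exi)].
    destruct Hd as [Hd|Hd].
    - apply (G2_not_boundary xi); [|exact Hbd]. rewrite Exi. apply G2_pi2; assumption.
    - apply (Hone d c Hd); [lra|]. rewrite Exi. apply pi2_sym. }
  intros V HV. split.
  + apply C2_lim_filterlim in Hu. destruct (Hu V HV) as [N HN].
    exists (Nat.iter (m N) f z0). split; [apply HN; lia|apply iter_G2; assumption].
  + exists (pi2 (a, b)). split; [exact (locally_singleton _ _ HV)|exact HnG].
- exists m. split; [intros k; apply Hn0|]. split; [exact Hm|].
  apply C2_lim_filterlim, Hu.
Qed.

Lemma cis_conj (t : R) (c : C) : (Cconj (cis t) * c = 1)%C -> c = cis t.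
Proof.
intros H. replace c with (cis t * (Cconj (cis t) * c))%C.
- rewrite H. ring.
- replace (cis t * (Cconj (cis t) * c))%C with ((Cconj (cis t) * cis t) * c)%C by ring.
  rewrite Cconj_unimodular by apply Cmod_cis. ring.
Qed.

(** * The two assertions on target sets *)

Theorem theorem1p9 :
  forall f : C * C -> C * C,
    (forall z, G2 z -> G2 (f z)) ->
    holomorphic_on G2 f ->
    ~ (exists z, G2 z /\ f z = z) ->
    ((exists z0, G2 z0 /\ subset (target_at f z0) royal_circle) ->
      subset (target f) royal_circle)
    /\
    (forall (z0 : C * C) (theta0 : R),
      G2 z0 ->
      subset (target_at f z0) (pi2_image unit_disc (fun z => z = cis theta0)) ->
      subset (target f)
        (fun xi => pi2_image closed_unit_disc (fun z => z = cis theta0) xi \/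
                   pi2_image (fun z => z = cis theta0) closed_unit_disc xi)).
Proof.
intros f Hmap Hhol _. split.
- intros [z0 [Hz0 Hsub]] xi [z [Hz Hxi]].
  destruct (target_transfer f z0 z xi Hmap Hhol Hz0 Hz Hxi)
    as [[c [d [Hc [Hd Exi]]]] [eta [Heta Hcomp]]].
  assert (Hroyal := Hsub eta Heta). destruct Hroyal as [t [Ht Eeta]].
  set (lam := Cconj (cis t)).
  assert (Hl : Cmod lam = 1) by (unfold lam; rewrite Cmod_conj; apply Cmod_cis).
  assert (Hlt : (lam * cis t = 1)%C) by (apply Cconj_unimodular, Cmod_cis).
  assert (Esq : (cis t * cis t)%C = cis (2 * t)).
  { unfold cis, Cmult; simpl. rewrite cos_2a, sin_2a. f_equal; ring. }
  assert (Epi : eta = pi2 (cis t, cis t)).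
  { rewrite Eeta. unfold pi2; simpl. rewrite Esq. f_equal; ring. }
  assert (H := Hcomp (peak lam) (peak_test lam Hl) (peak_continuous lam eta) (peak_continuous lam xi)).
  (* As [peak lam] vanishes at [eta], [Re (lam c) + Re (lam d) >= 2]; both moduli are at most 1, so
     [lam c = lam d = 1]. *)
  rewrite Epi, Exi, !peak_pi2, Hlt, re_RtoC in H. specialize (H ltac:(lra)).
  assert (Kc : Cmod (lam * c)%C <= 1) by (rewrite Cmod_mult, Hl; lra).
  assert (Kd : Cmod (lam * d)%C <= 1) by (rewrite Cmod_mult, Hl; lra).
  assert (Rc := Re_le_Cmod (lam * c)%C). assert (Rd := Re_le_Cmod (lam * d)%C).
  assert (Ec : c = cis t) by (apply cis_conj, Re_1_eq; [exact Kc|fold lam; lra]).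
  assert (Ed : d = cis t) by (apply cis_conj, Re_1_eq; [exact Kd|fold lam; lra]).
  exists t. split; [exact Ht|]. rewrite <- Eeta, Epi, Exi, Ec, Ed. reflexivity.
- intros z0 theta Hz0 Hsub xi [z [Hz Hxi]].
  destruct (target_transfer f z0 z xi Hmap Hhol Hz0 Hz Hxi)
    as [[c [d [Hc [Hd Exi]]]] [eta [Heta Hcomp]]].
  destruct (Hsub eta Heta) as [a [b [Ha [-> Eeta]]]]. unfold unit_disc in Ha.
  set (lam := Cconj (cis theta)).
  assert (Hl : Cmod lam = 1) by (unfold lam; rewrite Cmod_conj; apply Cmod_cis).
  assert (Hlt : (lam * cis theta = 1)%C) by (apply Cconj_unimodular, Cmod_cis).
  destruct (classic (lam * c = 1)%C) as [Ec|Ec].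
  { right. exists c, d. split; [apply cis_conj, Ec|split; [exact Hd|exact Exi]]. }
  destruct (classic (lam * d = 1)%C) as [Ed|Ed].
  { left. exists c, d. split; [exact Hc|split; [apply cis_conj, Ed|exact Exi]]. }
  (* With neither root of [xi] equal to [cis theta], [hmean lam] has positive real part at [xi]
     although it vanishes at [eta]. *)
  exfalso.
  destruct (hmean_vanishes lam a (cis theta) Hlt Hl) as [H1 H2]; [lra| |].
  { apply Cmod_lt_1_neq, Cmod_mult_lt_1; assumption. }
  destruct (hmean_pos lam c d) as [H3 H4];
    [rewrite Cmod_mult, Hl; lra|rewrite Cmod_mult, Hl; lra|exact Ec|exact Ed|].
  rewrite <- Eeta in H1, H2. rewrite <- Exi in H3, H4.
  assert (H := Hcomp (hmean lam) (hmean_test lam Hl)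
    (hmean_continuous lam eta Hl H1) (hmean_continuous lam xi Hl H3) H2).
  lra.
Qed.
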